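(* Let $(G'_t)_{t\ge0}$ be a sequence of matrices in $\mathbb R^{n\times p}$ converging to a matrix $G'$ such that $A-G'C$ is stable. Then, for $c\in(0,\bar c]$ sufficiently small (i.e. there is $c_0\in(0,\bar c]$ such that for all $c\in(0,c_0]$), the sequence $\Pi_t$ defined by $$\Pi_{t+1}=F_t\Pi_tF_t^T+M_tM_t^T,\qquad \Pi_0=I_2\otimes V_0,$$ with $$F_t=\tilde A-\begin{bmatrix}G'_t\\0\end{bmatrix}\tilde C,\qquad M_t=\tilde B-\begin{bmatrix}G'_t\\0\end{bmatrix}\tilde D,$$ converges as $t\to\infty$ to the solution $\Pi$ of the Lyapunov equation $$\Pi=F\Pi F^T+MM^T,\qquad F:=\tilde A-\begin{bmatrix}G'\\0\end{bmatrix}\tilde C,\quad M:=\tilde B-\begin{bmatrix}G'\\0\end{bmatrix}\tilde D .$$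
   Context: Notation. $\sigma(M)$ is the spectral radius of a square matrix $M$ (with $\sigma(M)^{-1}=+\infty$ if $\sigma(M)=0$); $M$ is stable if $\sigma(M)<1$. Inequalities between symmetric matrices are in the positive semidefinite (Loewner) order; $X>0$ means positive definite. Robust filter. $A\in\mathbb R^{n\times n}$, $B\in\mathbb R^{n\times m}$, $C\in\mathbb R^{p\times n}$, $D\in\mathbb R^{p\times m}$, with $(A,B)$ reachable, $(A,C)$ observable, $BD^T=0$, $m=n+p$, and the stacked matrix $[B^T\ D^T]^T$ square and invertible. For a tolerance $c>0$ and $P_0>0$, put $V_0=P_0$ and for $t\ge0$ $$G_t=AV_tC^T(CV_tC^T+DD^T)^{-1},\quad P_{t+1}=A(V_t^{-1}+C^T(DD^T)^{-1}C)^{-1}A^T+BB^T,\quad V_{t+1}=(P_{t+1}^{-1}-\theta_tI)^{-1},$$ where $\theta_t\in(0,\sigma(P_{t+1})^{-1})$ is the unique solution of $c=\gamma(P_{t+1},\theta_t)$, with $\gamma(P,\theta)=\frac12\left[\log\det(I-\theta P)+\mathrm{tr}[(I-\theta P)^{-1}]-n\right]$. Known fact: there is $c_{MAX}>0$ such that for $c\in(0,c_{MAX}]$ and any $P_0>0$: $P_t\to P>0$, $\theta_t\to\theta>0$, $V_t\to V>0$, $G_t\to G$ with $A-GC$ stable, and $P$ is the unique solution of $P=A(P^{-1}-\theta I+C^T(DD^T)^{-1}C)^{-1}A^T+BB^T$. Fix such a $c_{MAX}$. For $c\in(0,c_{MAX}]$ the symbols $\theta,P,V,G$ denote these limits (depending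 on $c$), and $\bar A:=A-GC$ (stable), $\bar B:=B-GD$; $\bar B\bar B^T$ is invertible. $\bar A,\bar B$ depend on $c$ through $\theta$; for $\theta=0$ they are given by the same formulas with $P$ the solution of the Riccati equation above for $\theta=0$ (standard Kalman filter, $V=P$). Standing assumption (Assumption 1): for $\check\theta>0$ sufficiently small, the map $\theta\mapsto(\bar A,\bar B)$ is continuous on $[0,\check\theta]$. The constant $\bar c$. For $\rho\in(1,\sigma(\bar A)^{-1})$, $\Sigma_\rho$ is the unique solution of $\Sigma_\rho=\rho^2\bar A^T\Sigma_\rho\bar A+\theta I$. $\bar c\in(0,c_{MAX}]$ is fixed such that there is a $\rho>1$ for which, for every $c\in(0,\bar c]$ (with the corresponding $\theta,\bar A,\bar B$), one has $\rho\in(1,\sigma(\bar A)^{-1})$ and $(1-\rho^{-2})\Sigma_\rho^{-1}-\bar B\bar B^T\ge0$. Steady-state least favorable model. For $c\in(0,\bar c]$, the backward recursion $X_t=\bar A^T(X_{t+1}^{-1}-\bar B\bar B^T)^{-1}\bar A+\theta I$, $X_T=\theta I$, converges as $t\to-\infty$ to a matrix $X$ with $\theta I\le X\le\Sigma_\rho<(\bar B\bar B^T)^{-1}$. Put $$\tilde K=(I-\bar B^TX\bar B)^{-1}=LL^T,\quad H=\tilde K\bar B^TX\bar A,$$ $$\tilde A=\begin{bmatrix}A&BH\\0&\bar A+\bar BH\end{bmatrix},\quad \tilde B=\begin{bmatrix}B\\ \bar B\end{bmatrix}L,\quad \tilde C=\begin{bmatrix}C&DH\end{bmatrix},\quad \tilde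 D=DL .$$ The matrix $\Pi_t$ is the covariance of the joint vector $[e_t'^{\,T}\ e_t^T]^T$, where $e'_t=x_t-\hat x'_t$ is the prediction error of the filter $\hat x'_{t+1}=A\hat x'_t+G'_t(y_t-C\hat x'_t)$ and $e_t$ that of the robust filter, under the steady-state least favorable model. *)

(* Defs.v *)
From HB Require Import structures.
From mathcomp Require Import all_boot all_order all_algebra.
From mathcomp Require Import all_classical all_reals all_analysis.
From mathcomp Require Import complex.

Set Implicit Arguments.
Unset Strict Implicit.
Unset Printing Implicit Defensive.

Import Order.TTheory GRing.Theory Num.Theory.
Import numFieldNormedType.Exports.

Local Open Scope classical_set_scope.
Local Open Scope ring_scope.

Section MatrixNotions.
Variable R : realType.

(* The supremum is taken over a finite set, nonempty as soon as 0 < n. *)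
Definition spectral_radius n (M : 'M[R]_n) : R :=
  sup [set ComplexField.Normc.normc z | z in
        [set z : R[i] | eigenvalue (map_mx (real_complex R) M) z]].

(* [inve] sends 0 to +oo, and any other finite r to r^-1. *)
Definition inv_spectral_radius n (M : 'M[R]_n) : \bar R :=
  ((spectral_radius M)%:E^-1)%E.

Definition stable n (M : 'M[R]_n) : Prop := spectral_radius M < 1.

Definition symmx n (M : 'M[R]_n) : Prop := M^T = M.

Definition psdmx n (M : 'M[R]_n) : Prop :=
  symmx M /\ forall x : 'cV[R]_n, 0 <= (x^T *m M *m x) 0 0.

Definition pdmx n (M : 'M[R]_n) : Prop :=
  symmx M /\ forall x : 'cV[R]_n, x != 0 -> 0 < (x^T *m M *m x) 0 0.

Definition reachable n m (A : 'M[R]_n) (B : 'M[R]_(n, m)) : Prop :=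
  \rank (\mxrow_(i < n) (A ^+ i *m B)) = n.

Definition observable n p (A : 'M[R]_n) (C : 'M[R]_(p, n)) : Prop :=
  \rank (\mxcol_(i < n) (C *m A ^+ i)) = n.

Definition risk_gamma n (P : 'M[R]_n) (th : R) : R :=
  2^-1 * (ln (\det (1%:M - th *: P)) + \tr (invmx (1%:M - th *: P)) - n%:R).

End MatrixNotions.

Section RobustFilter.
Variables (R : realType) (n p : nat).
Variables (A : 'M[R]_n) (B : 'M[R]_(n, n + p)).
Variables (C : 'M[R]_(p, n)) (D : 'M[R]_(p, n + p)).

Record filter_model : Prop := FilterModel {
  model_reachable : reachable A B;
  model_observable : observable A C;
  model_BD : B *m D^T = 0;
  model_unit : col_mx B D \in unitmx }.

Definition gain (V : 'M[R]_n) : 'M[R]_(n, p) :=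
  A *m V *m C^T *m invmx (C *m V *m C^T + D *m D^T).

Definition next_P (V : 'M[R]_n) : 'M[R]_n :=
  A *m invmx (invmx V + C^T *m invmx (D *m D^T) *m C) *m A^T + B *m B^T.

Definition risk_V (P : 'M[R]_n) (th : R) : 'M[R]_n := invmx (invmx P - th%:M).

Definition risk_parameter (c : R) (P : 'M[R]_n) (th : R) : Prop :=
  [/\ 0 < th, (th%:E < inv_spectral_radius P)%E & c = risk_gamma P th].

Record robust_filter (c : R) (P0 : 'M[R]_n) (P_ V_ : nat -> 'M[R]_n)
    (th_ : nat -> R) (G_ : nat -> 'M[R]_(n, p)) : Prop := RobustFilter {
  filter_P0 : P_ 0%N = P0;
  filter_V0 : V_ 0%N = P0;
  filter_G : forall t, G_ t = gain (V_ t);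
  filter_P : forall t, P_ t.+1 = next_P (V_ t);
  filter_th : forall t, unique (risk_parameter c (P_ t.+1)) (th_ t);
  filter_V : forall t, V_ t.+1 = risk_V (P_ t.+1) (th_ t) }.

(* Solutions are sought among the P > 0 for which V = (P^-1 - theta I)^-1 is
   positive definite; elsewhere the filter is meaningless. For theta = 0 this
   is P > 0. *)
Definition riccati_solution (th : R) (P : 'M[R]_n) : Prop :=
  [/\ pdmx P, pdmx (invmx P - th%:M) &
      P = A *m invmx (invmx P - th%:M + C^T *m invmx (D *m D^T) *m C) *m A^T
          + B *m B^T].

(* theta, P, V, G are the limits of the filter as functions of the tolerance c;
   they do not depend on the initial condition P0. *)
Definition filter_limits (cmax : R) (theta : R -> R) (P V : R -> 'M[R]_n)
    (G : R -> 'M[R]_(n, p)) : Prop :=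
  forall c, 0 < c <= cmax ->
  [/\ forall P0, pdmx P0 -> exists P_ V_ th_ G_,
        robust_filter c P0 P_ V_ th_ G_ /\
        [/\ P_ @ \oo --> P c, V_ @ \oo --> V c,
            th_ @ \oo --> theta c & G_ @ \oo --> G c],
      [/\ pdmx (P c), 0 < theta c & pdmx (V c)],
      stable (A - G c *m C) &
      unique (riccati_solution (theta c)) (P c)].

Definition Abar (G : 'M[R]_(n, p)) : 'M[R]_n := A - G *m C.
Definition Bbar (G : 'M[R]_(n, p)) : 'M[R]_(n, n + p) := B - G *m D.

Definition bar_continuity : Prop :=
  exists2 thmax : R, 0 < thmax &
  exists2 P : R -> 'M[R]_n,
    forall th, 0 <= th <= thmax -> unique (riccati_solution th) (P th) &
    {within `[0, thmax], continuous (fun th : R =>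
      (Abar (gain (risk_V (P th) th)), Bbar (gain (risk_V (P th) th))))}.

Definition Sigma_solution (rho th : R) (Ab S : 'M[R]_n) : Prop :=
  S = rho ^+ 2 *: (Ab^T *m S *m Ab) + th%:M.

Definition admissible_cbar (theta : R -> R) (G : R -> 'M[R]_(n, p))
    (cbar : R) : Prop :=
  exists2 rho : R, 1 < rho &
  forall c, 0 < c <= cbar ->
    (rho%:E < inv_spectral_radius (Abar (G c)))%E /\
    exists2 S : 'M[R]_n, unique (Sigma_solution rho (theta c) (Abar (G c))) S &
      psdmx ((1 - rho ^- 2) *: invmx S - Bbar (G c) *m (Bbar (G c))^T).

Section LeastFavorableModel.
Variable G : 'M[R]_(n, p).

(* Time-reversed: [backward_X th k] is X_(T - k). *)
Fixpoint backward_X (th : R) (k : nat) : 'M[R]_n :=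
  if k is k'.+1 then
    (Abar G)^T *m invmx (invmx (backward_X th k') - Bbar G *m (Bbar G)^T)
      *m Abar G + th%:M
  else th%:M.

Definition Ktilde (X : 'M[R]_n) : 'M[R]_(n + p) :=
  invmx (1%:M - (Bbar G)^T *m X *m Bbar G).

Definition Hmx (X : 'M[R]_n) : 'M[R]_(n + p, n) :=
  Ktilde X *m (Bbar G)^T *m X *m Abar G.

Definition Atilde (X : 'M[R]_n) : 'M[R]_(n + n) :=
  block_mx A (B *m Hmx X) 0 (Abar G + Bbar G *m Hmx X).

Definition Btilde (L : 'M[R]_(n + p)) : 'M[R]_(n + n, n + p) :=
  col_mx B (Bbar G) *m L.

Definition Ctilde (X : 'M[R]_n) : 'M[R]_(p, n + n) := row_mx C (D *m Hmx X).

Definition Dtilde (L : 'M[R]_(n + p)) : 'M[R]_(p, n + p) := D *m L.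

Definition Fmx (X : 'M[R]_n) (G' : 'M[R]_(n, p)) : 'M[R]_(n + n) :=
  Atilde X - col_mx G' 0 *m Ctilde X.

Definition Mmx (L : 'M[R]_(n + p)) (G' : 'M[R]_(n, p)) :
    'M[R]_(n + n, n + p) :=
  Btilde L - col_mx G' 0 *m Dtilde L.

(* The initial value block_mx V0 0 0 V0 is the Kronecker product of the 2 x 2
   identity with V0. *)
Fixpoint Pi_seq (X : 'M[R]_n) (L : 'M[R]_(n + p)) (G'_ : nat -> 'M[R]_(n, p))
    (V0 : 'M[R]_n) (t : nat) : 'M[R]_(n + n) :=
  if t is t'.+1 then
    Fmx X (G'_ t') *m Pi_seq X L G'_ V0 t' *m (Fmx X (G'_ t'))^T
    + Mmx L (G'_ t') *m (Mmx L (G'_ t'))^T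
  else block_mx V0 0 0 V0.

Definition Lyapunov_solution (X : 'M[R]_n) (L : 'M[R]_(n + p))
    (G' : 'M[R]_(n, p)) (Pi : 'M[R]_(n + n)) : Prop :=
  Pi = Fmx X G' *m Pi *m (Fmx X G')^T + Mmx L G' *m (Mmx L G')^T.

End LeastFavorableModel.
End RobustFilter.

(* Main.v *)
(* The matrix F is block triangular, with diagonal blocks A - G'C and
   Z = Abar + Bbar H.  A matrix is treated as stable when it admits a positive
   definite W with W - F W F^T > 0: for A - G'C such a W is a partial sum of
   sum_k F^k (F^k)^T, where F^k -> 0 by Cayley-Hamilton, and two such blocks
   combine into one for the triangular matrix.

   For Z one lets c -> 0.  Since ln det N + n <= tr N, with a gap controlled by
   a diagonal entry, and P >= B B^T > 0, the equation c = gamma(P, theta) forces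
   theta -> 0, so (Abar, Bbar) tends to its value at theta = 0.  There the
   Riccati equation reads P = Abar P Abar^T + Bbar Bbar^T, so P itself is a
   Lyapunov matrix.  Its inverse serves for the transpose and bounds the backward
   recursion by a multiple of theta; hence X -> 0, H -> 0 and Z tends to
   Abar at theta = 0, which leaves the strict Lyapunov inequality intact.

   Finally a strict Lyapunov inequality for F makes E |-> F_t E F_t^T a
   contraction, uniformly in t large, for the size
   sup |x^T E y| / (W[x] + W[y]), so Pi_t - Pi -> 0. *)

Require Import Defs.
From mathcomp Require Import all_boot all_order all_algebra.
From mathcomp Require Import all_classical all_reals all_analysis.
From mathcomp Require Import complex.
From mathcomp Require Import ring lra.
Import Order.TTheory GRing.Theory Num.Theory.
Import numFieldNormedType.Exports.

Local Open Scope classical_set_scope.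
Local Open Scope ring_scope.
Set Implicit Arguments.
Unset Strict Implicit.
Unset Printing Implicit Defensive.

(** * Bilinear forms, positive definite matrices and the Loewner order *)

Section QuadraticForms.
Variable R : realType.

(** Bilinear and rectangular: basis vectors recover single entries, and [bform 1%:M] is the
    Euclidean inner product. *)
Definition bform m n (M : 'M[R]_(m, n)) (x : 'cV[R]_m) (y : 'cV[R]_n) : R :=
  (x^T *m M *m y) 0 0.

Definition normsq n (x : 'cV[R]_n) : R := bform 1%:M x x.

Section Bform.
Variables m n : nat.
Implicit Types (M N : 'M[R]_(m, n)) (x : 'cV[R]_m) (y : 'cV[R]_n).

Lemma bformD M N x y : bform (M + N) x y = bform M x y + bform N x y.
Proof. by rewrite /bform mulmxDr mulmxDl mxE. Qed.

Lemma bformN M x y : bform (- M) x y = - bform M x y.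
Proof. by rewrite /bform mulmxN mulNmx mxE. Qed.

Lemma bformB M N x y : bform (M - N) x y = bform M x y - bform N x y.
Proof. by rewrite bformD bformN. Qed.

Lemma bformZ a M x y : bform (a *: M) x y = a * bform M x y.
Proof. by rewrite /bform -scalemxAr -scalemxAl mxE. Qed.

Lemma bformDl M x1 x2 y : bform M (x1 + x2) y = bform M x1 y + bform M x2 y.
Proof. by rewrite /bform linearD !mulmxDl mxE. Qed.

Lemma bformDr M x y1 y2 : bform M x (y1 + y2) = bform M x y1 + bform M x y2.
Proof. by rewrite /bform mulmxDr mxE. Qed.

Lemma bformZl a M x y : bform M (a *: x) y = a * bform M x y.
Proof. by rewrite /bform linearZ /= -!scalemxAl mxE. Qed.

Lemma bformZr a M x y : bform M x (a *: y) = a * bform M x y.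
Proof. by rewrite /bform -scalemxAr mxE. Qed.

Lemma bform_tr M x y : bform M^T y x = bform M x y.
Proof.
rewrite /bform; have -> : y^T *m M^T *m x = (x^T *m M *m y)^T.
  by rewrite !trmx_mul trmxK mulmxA.
by rewrite mxE.
Qed.

Lemma bform_delta M i j : bform M (delta_mx i 0) (delta_mx j 0) = M i j.
Proof. by rewrite /bform trmx_delta -rowE -colE !mxE. Qed.

Lemma bform_sum M x y : bform M x y = \sum_i \sum_j x i 0 * M i j * y j 0.
Proof.
rewrite /bform mxE exchange_big; apply: eq_bigr => j _ /=.
by rewrite mxE big_distrl; apply: eq_bigr => i _; rewrite mxE.
Qed.

End Bform.

Lemma bform_mul m n k l (M : 'M[R]_(m, n)) (S : 'M[R]_(k, m)) (U : 'M[R]_(n, l)) x y :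
  bform (S *m M *m U) x y = bform M (S^T *m x) (U *m y).
Proof. by rewrite /bform trmx_mul trmxK !mulmxA. Qed.

Lemma bform_scalar n (a : R) (x : 'cV[R]_n) : bform a%:M x x = a * normsq x.
Proof. by rewrite -[a%:M]scalemx1 bformZ. Qed.

Lemma normsqE n (x : 'cV[R]_n) : normsq x = \sum_i x i 0 ^+ 2.
Proof.
by rewrite /normsq /bform mulmx1 mxE; apply: eq_bigr => i _; rewrite mxE expr2.
Qed.

Lemma normsq_ge0 n (x : 'cV[R]_n) : 0 <= normsq x.
Proof. by rewrite normsqE sumr_ge0 // => i _; exact: sqr_ge0. Qed.

Lemma normsq_eq0 n (x : 'cV[R]_n) : normsq x = 0 -> x = 0.
Proof.
rewrite normsqE => /psumr_eq0P x0; apply/colP => i; rewrite mxE.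
by apply/eqP; rewrite -sqrf_eq0 x0 // => j _; exact: sqr_ge0.
Qed.

Lemma normsq_gt0 n (x : 'cV[R]_n) : x != 0 -> 0 < normsq x.
Proof.
move=> x0; rewrite lt_def normsq_ge0 andbT.
by apply: contra_neq x0 => /normsq_eq0.
Qed.

Lemma mx_entry_le m n (M : 'M[R]_(m, n)) i j : `|M i j| <= `|M|.
Proof.
rewrite [leRHS]/Num.Def.normr /= mx_normrE.
by apply/bigmax_geP; right; exists (i, j).
Qed.

(* AM-GM on each term x_i M_ij y_j *)
Lemma bform_le m n (M : 'M[R]_(m, n)) x y :
  `|bform M x y| <= `|M| * (m + n)%:R * (normsq x + normsq y).
Proof.
have le1 : `|bform M x y| <= \sum_i \sum_j `|M| * (x i 0 ^+ 2 + y j 0 ^+ 2).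
  rewrite bform_sum; apply: (le_trans (ler_norm_sum _ _ _)); apply: ler_sum => i _.
  apply: (le_trans (ler_norm_sum _ _ _)); apply: ler_sum => j _.
  rewrite !normrM mulrAC mulrC; apply: ler_pM; rewrite ?mulr_ge0 //.
    exact: mx_entry_le.
  rewrite -(real_normK (num_real (x i 0))) -(real_normK (num_real (y j 0))).
  have := normr_ge0 (x i 0); have := normr_ge0 (y j 0); nra.
apply: (le_trans le1).
have -> : \sum_i \sum_j `|M| * (x i 0 ^+ 2 + y j 0 ^+ 2) =
          `|M| * (n%:R * normsq x + m%:R * normsq y).
  under eq_bigr do rewrite -mulr_sumr big_split /= sumr_const card_ord.
  rewrite -mulr_sumr big_split /= sumr_const card_ord sumrMnl !normsqE.
  by rewrite !mulr_natl.
rewrite -mulrA ler_wpM2l // natrD.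
have := normsq_ge0 x; have := normsq_ge0 y.
have := ler0n R m; have := ler0n R n; nra.
Qed.

Lemma pdmx_sym n (W : 'M[R]_n) : pdmx W -> W^T = W. Proof. by case. Qed.
Lemma pdmx_psd n (W : 'M[R]_n) : pdmx W -> psdmx W.
Proof.
case=> Ws W0; split=> // x; have [->|/W0/ltW//] := eqVneq x 0.
by rewrite mulmx0 mxE.
Qed.

Lemma pdmx_ge0 n (W : 'M[R]_n) x : pdmx W -> 0 <= bform W x x.
Proof. by move=> /pdmx_psd[_]; exact. Qed.

(** A row of the left kernel, read as a column, annihilates the form and so vanishes. *)
Lemma pdmx_unit n (W : 'M[R]_n) : pdmx W -> W \in unitmx.
Proof.
move=> [Ws W0]; rewrite -row_free_unit -kermx_eq0; apply/eqP/row_matrixP => i.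
rewrite row0; apply/eqP; apply: contraT => k0.
have /W0 : (row i (kermx W))^T != 0 by rewrite -trmx0 (inj_eq trmx_inj).
by rewrite trmxK -row_mul mulmx_ker row0 mul0mx mxE ltxx.
Qed.

Lemma trmxV n (W : 'M[R]_n) : W^T = W -> (invmx W)^T = invmx W.
Proof. by move=> Ws; rewrite trmx_inv Ws. Qed.

Lemma pdmxV n (W : 'M[R]_n) : pdmx W -> pdmx (invmx W).
Proof.
move=> Wpd; have Wu := pdmx_unit Wpd; have [Ws W0] := Wpd.
split; first exact: trmxV.
move=> x x0; have /W0 : invmx W *m x != 0.
  by apply: contra_neq x0 => /(congr1 (mulmx W)); rewrite mulKVmx // mulmx0.
by rewrite trmx_mul trmxV // !mulmxA mulmxKV.
Qed.

Lemma pdmxD n (W X : 'M[R]_n) : pdmx W -> psdmx X -> pdmx (W + X).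
Proof.
move=> [Ws W0] [Xs X0]; split; first by rewrite /symmx linearD /= Ws Xs.
move=> x /W0 Wx; rewrite -/(bform (W + X) x x) bformD.
exact: ltr_wpDr (X0 x) Wx.
Qed.

Lemma psdmx_congr m n (X : 'M[R]_m) (S : 'M[R]_(n, m)) :
  psdmx X -> psdmx (S *m X *m S^T).
Proof.
move=> [Xs X0]; split; first by rewrite /symmx !trmx_mul trmxK Xs mulmxA.
by move=> x; rewrite -/(bform (S *m X *m S^T) x x) bform_mul; exact: X0.
Qed.

Lemma pdmx_scalar n (a : R) : 0 < a -> pdmx (a%:M : 'M[R]_n).
Proof.
move=> a0; split; first by rewrite /symmx tr_scalar_mx.
by move=> x /normsq_gt0 x0; rewrite -/(bform _ x x) bform_scalar mulr_gt0.
Qed.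

Lemma psdmx_gram m n (S : 'M[R]_(n, m)) : psdmx (S *m S^T).
Proof. by rewrite -[S in S *m _]mulmx1; exact/psdmx_congr/pdmx_psd/pdmx_scalar. Qed.

(* The form of W at x - W^-1 y is nonnegative. *)
Lemma pdmx_fenchel n (W : 'M[R]_n) x y : pdmx W ->
  2 * bform 1%:M x y <= bform W x x + bform (invmx W) y y.
Proof.
move=> Wpd; have Wu := pdmx_unit Wpd; have Ws := pdmx_sym Wpd.
have := pdmx_ge0 (x - invmx W *m y) Wpd.
rewrite -scaleN1r !(bformDl, bformDr, bformZl, bformZr).
have <- : bform 1%:M x y = bform W x (invmx W *m y).
  by rewrite /bform mulmx1 mulmxA mulmxK.
have <- : bform 1%:M x y = bform W (invmx W *m y) x.
  by rewrite -bform_tr tr_scalar_mx /bform trmx_mul trmxV // mulmx1 mulmxKV.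
have <- : bform (invmx W) y y = bform W (invmx W *m y) (invmx W *m y).
  by rewrite /bform trmx_mul trmxV // !mulmxA mulmxKV.
lra.
Qed.

(** Equality case of the Fenchel inequality, at [x = invmx W *m y]. *)
Lemma pdmx_fenchel_eq n (W : 'M[R]_n) y : pdmx W ->
  bform (invmx W) y y =
    2 * bform 1%:M (invmx W *m y) y - bform W (invmx W *m y) (invmx W *m y).
Proof.
move=> Wpd; have Wu := pdmx_unit Wpd; have Ws := pdmx_sym Wpd.
rewrite /bform trmx_mul trmxV // !mulmx1 !mulmxA mulmxKV //; lra.
Qed.

(** The form of [invmx X] at [x] is attained at [invmx X *m x]; the Fenchel inequality for [W] at
    that same point gives the comparison. *)
Lemma pdmxV_antitone n (W X : 'M[R]_n) : pdmx W -> pdmx X ->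
  (forall x, bform W x x <= bform X x x) ->
  forall x, bform (invmx X) x x <= bform (invmx W) x x.
Proof.
move=> Wpd Xpd WX x; rewrite pdmx_fenchel_eq //.
have := pdmx_fenchel (invmx X *m x) x Wpd; have := WX (invmx X *m x); lra.
Qed.

Lemma bform_upper n (W : 'M[R]_n) :
  exists2 k : R, 0 < k & forall x, bform W x x <= k * normsq x.
Proof.
exists (`|W| * (n + n)%:R * 2 + 1) => [|x]; first by rewrite ltr_wpDl // mulr_ge0.
have := bform_le W x x; have := ler_norm (bform W x x).
have := normsq_ge0 x; lra.
Qed.

(** An upper bound [k] for [invmx W], inverted by antitonicity, is a lower bound [k^-1] for [W]. *)
Lemma pdmx_lower n (W : 'M[R]_n) : pdmx W ->
  exists2 e : R, 0 < e & forall x, e * normsq x <= bform W x x.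
Proof.
move=> Wpd; have [k k0 kP] := bform_upper (invmx W).
exists k^-1; first by rewrite invr_gt0.
move=> x; have := @pdmxV_antitone n (invmx W) k%:M (pdmxV Wpd) (pdmx_scalar n k0).
rewrite invmxK invmx_scalar => /(_ _ x); rewrite bform_scalar; apply.
by move=> y; rewrite bform_scalar.
Qed.

(* s = y^T F x with y = P^-1 F x satisfies 2 s <= q^-1 P[F^T y] + q P^-1[x]. *)
Lemma contraction_dual n (P F : 'M[R]_n) (q : R) : pdmx P -> 0 < q ->
  (forall x, bform P (F^T *m x) (F^T *m x) <= q * bform P x x) ->
  forall x, bform (invmx P) (F *m x) (F *m x) <= q * bform (invmx P) x x.
Proof.
move=> Ppd q0 FP x; have Pu := pdmx_unit Ppd; have Ps := pdmx_sym Ppd.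
set y := invmx P *m (F *m x).
have yP : bform P y y = bform (invmx P) (F *m x) (F *m x).
  by rewrite /bform trmx_mul trmxV // !mulmxA mulmxKV.
have yx : bform 1%:M (F^T *m y) x = bform (invmx P) (F *m x) (F *m x).
  by rewrite /bform !trmx_mul trmxK trmxV // !mulmxA mulmx1.
have := pdmx_fenchel (q^-1 *: (F^T *m y)) x Ppd.
rewrite !(bformZl, bformZr) yx; have := FP y; rewrite yP.
set s := bform _ (F *m x) _; set u := bform P _ _; set v := bform _ x x.
move=> us h; have : 2 * s <= q^-1 * u + q * v.
  have := ler_wpM2l (ltW q0) h; rewrite mulrDr !mulrA.
  by rewrite [q * 2]mulrC -!mulrA !mulVKf ?mulKf ?gt_eqF //; nra.
have : q^-1 * u <= s by rewrite ler_pdivrMl.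
lra.
Qed.

End QuadraticForms.

(** * Limits of matrix-valued functions along a filter *)

Section MatrixConvergence.
Variable R : realType.

Section Filtered.
Context {T : Type} {F : set_system T} {FF : Filter F}.

Lemma cvg_bigsum I (r : seq I) (P : pred I) (f : I -> T -> R) (l : I -> R) :
  (forall i, f i t @[t --> F] --> l i) ->
  \sum_(i <- r | P i) f i t @[t --> F] --> \sum_(i <- r | P i) l i.
Proof.
move=> fl; elim: r => [|i r IH].
  rewrite big_nil; under eq_fun do rewrite big_nil; exact: cvg_cst.
rewrite big_cons; under eq_fun do rewrite big_cons.
by case: (P i) => //; apply: cvgD => //.
Qed.

Lemma cvg_bigprod I (r : seq I) (P : pred I) (f : I -> T -> R) (l : I -> R) :
  (forall i, f i t @[t --> F] --> l i) ->
  \prod_(i <- r | P i) f i t @[t --> F] --> \prod_(i <- r | P i) l i.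
Proof.
move=> fl; elim: r => [|i r IH].
  rewrite big_nil; under eq_fun do rewrite big_nil; exact: cvg_cst.
rewrite big_cons; under eq_fun do rewrite big_cons.
by case: (P i) => //; apply: cvgM => //.
Qed.

Lemma cvg_mxP m n (M : T -> 'M[R]_(m, n)) (N : 'M[R]_(m, n)) :
  M t @[t --> F] --> N <-> forall i j, M t i j @[t --> F] --> N i j.
Proof.
split=> [MN i j|MN].
  have h := @coord_continuous R m n i j N; have := cvg_comp _ _ MN h; exact.
move=> A [P NP PA]; rewrite /nbhs /=.
suff : \forall t \near F, forall i j, P i j (M t i j).
  by apply: filterS => t Pt; apply: PA.
by apply: filter_forall => i; apply: filter_forall => j; apply: MN; exact: NP.
Qed.

Lemma cvg_mulmx m n p (M : T -> 'M[R]_(m, n)) (N : T -> 'M[R]_(n, p))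
    (M0 : 'M[R]_(m, n)) (N0 : 'M[R]_(n, p)) :
  M t @[t --> F] --> M0 -> N t @[t --> F] --> N0 ->
  M t *m N t @[t --> F] --> M0 *m N0.
Proof.
move=> /cvg_mxP MM /cvg_mxP NN; apply/cvg_mxP => i j.
rewrite mxE; under eq_fun do rewrite mxE.
by apply: cvg_bigsum => k; exact: cvgM.
Qed.

Lemma cvg_trmx m n (M : T -> 'M[R]_(m, n)) (M0 : 'M[R]_(m, n)) :
  M t @[t --> F] --> M0 -> (M t)^T @[t --> F] --> M0^T.
Proof.
move=> /cvg_mxP MM; apply/cvg_mxP => i j.
by rewrite mxE; under eq_fun do rewrite mxE; exact: MM.
Qed.

Lemma cvg_scalar_mx n (a : T -> R) (a0 : R) :
  a t @[t --> F] --> a0 -> ((a t)%:M : 'M[R]_n) @[t --> F] --> (a0%:M : 'M[R]_n).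
Proof.
move=> aa; apply/cvg_mxP => i j; rewrite mxE; under eq_fun do rewrite mxE.
by case: (i == j); [rewrite mulr1n; exact: aa|exact: cvg_cst].
Qed.

Lemma cvg_det n (M : T -> 'M[R]_n) (M0 : 'M[R]_n) :
  M t @[t --> F] --> M0 -> \det (M t) @[t --> F] --> \det M0.
Proof.
move=> /cvg_mxP MM; apply: cvg_bigsum => s; apply: cvgM; first exact: cvg_cst.
by apply: cvg_bigprod => i; exact: MM.
Qed.

Lemma cvg_invmx n (M : T -> 'M[R]_n) (M0 : 'M[R]_n) : M0 \in unitmx ->
  M t @[t --> F] --> M0 -> invmx (M t) @[t --> F] --> invmx M0.
Proof.
move=> M0u MM; have det0 : \det M0 != 0 by rewrite -unitfE -unitmxE.
have detM := cvg_det MM.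
have adjM : (\det (M t))^-1 *: \adj (M t) @[t --> F] --> invmx M0.
  rewrite /invmx M0u; apply: cvgZ; first exact: cvgV.
  apply/cvg_mxP => i j; rewrite mxE; under eq_fun do rewrite mxE.
  apply: cvgM; first exact: cvg_cst.
  apply: cvg_det; apply/cvg_mxP => k l; rewrite !mxE.
  under eq_fun do rewrite !mxE.
  by move/cvg_mxP: MM; exact.
(* On a singular matrix [invmx] returns its argument, so the cofactor formula agrees with it only
   eventually, once the determinant is nonzero. *)
apply: cvg_trans adjM; apply: near_eq_cvg.
near=> t; have dett : \det (M t) != 0 by near: t; exact: cvgr_neq0 detM det0.
by rewrite /invmx unitmxE unitfE dett.
Unshelve. all: by end_near.
Qed.

Lemma cvg_col_mx m1 m2 n (M : T -> 'M[R]_(m1, n)) (N : T -> 'M[R]_(m2, n))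
    (M0 : 'M[R]_(m1, n)) (N0 : 'M[R]_(m2, n)) :
  M t @[t --> F] --> M0 -> N t @[t --> F] --> N0 ->
  col_mx (M t) (N t) @[t --> F] --> col_mx M0 N0.
Proof.
move=> /cvg_mxP MM /cvg_mxP NN; apply/cvg_mxP => i j.
rewrite mxE; under eq_fun do rewrite mxE.
by case: (fintype.split i) => k; [exact: MM|exact: NN].
Qed.

End Filtered.

(** With W - F W F^T >= e I and W <= k I, half of the gap e yields the ratio [q], and the other half
    absorbs the perturbation of [F]. *)
Lemma near_contraction {T : Type} {G : set_system T} {FG : Filter G}
    n (W F : 'M[R]_n) (F_ : T -> 'M[R]_n) :
  pdmx W -> pdmx (W - F *m W *m F^T) -> F_ t @[t --> G] --> F ->
  exists2 q : R, 0 < q < 1 & \forall t \near G, forall x,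
    bform W ((F_ t)^T *m x) ((F_ t)^T *m x) <= q * bform W x x.
Proof.
move=> Wpd Lpd FF; have [e e0 eP] := pdmx_lower Lpd.
have [k k0 kP] := bform_upper W.
(* Taking [k + e] in place of [k] keeps [q] positive without comparing [e] and [k]. *)
have q1 : 0 < e / (2 * (k + e)) < 1.
  rewrite divr_gt0 ?mulr_gt0 ?addr_gt0 //= ltr_pdivrMr ?mulr_gt0 ?addr_gt0 //; lra.
exists (1 - e / (2 * (k + e))); first by move: q1; lra.
have : (F_ t *m W *m (F_ t)^T - F *m W *m F^T) @[t --> G] --> (0 : 'M[R]_n).
  rewrite -(subrr (F *m W *m F^T)); apply: cvgB; last exact: cvg_cst.
  apply: cvg_mulmx; last exact: cvg_trmx.
  by apply: cvg_mulmx => //; exact: cvg_cst.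
(* Tuned so that [bform_le] bounds the perturbation by [e / 2 * normsq x]; the successor keeps the
   denominator nonzero in dimension 0. *)
have d0 : 0 < e / (4 * (n + n).+1%:R) by rewrite divr_gt0 // mulr_gt0.
move=> /cvgr0_norm_le /(_ _ d0); apply: filterS => t Ft x.
have := bform_le (F_ t *m W *m (F_ t)^T - F *m W *m F^T) x x.
move=> /(le_trans (ler_norm _)).
have Lx := eP x; have kx := kP x; have x0 := normsq_ge0 x.
move: Lx; rewrite !(bformB, bform_mul) => Lx.
set w := bform W _ _ in Lx kx *; set v := bform W (F^T *m x) _ in Lx *.
move=> h; set u := bform W _ _ in h *.
have h2 : u - v <= e / 2 * normsq x.
  apply: (le_trans h).
  suff : `|F_ t *m W *m (F_ t)^T - F *m W *m F^T| * (n + n)%:R <= e / 4 by nra.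
  apply: (@le_trans _ _ (e / (4 * (n + n).+1%:R) * (n + n).+1%:R)).
    by rewrite ler_pM // ler_nat.
  by rewrite invfM mulrA mulfVK ?pnatr_eq0.
have h3 : e / (2 * (k + e)) * w <= e / 2 * normsq x.
  rewrite mulrAC ler_pdivrMr ?mulr_gt0 ?addr_gt0 //.
  have := ler_wpM2l (ltW e0) kx; have : 0 <= e * e * normsq x by rewrite !mulr_ge0 // ltW.
  lra.
lra.
Qed.

End MatrixConvergence.

(** * Stability and strict Lyapunov inequalities *)

Section LyapunovInequality.
Variable R : realType.

Lemma cvg0_contraction (q : R) (a b : nat -> R) : 0 <= q < 1 ->
  (forall t, 0 <= a t) ->
  (\forall t \near \oo, a t.+1 <= q * a t + b t) ->
  b t @[t --> \oo] --> 0 -> a t @[t --> \oo] --> 0.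
Proof.
move=> /andP[q0 q1] a0 ab b0; apply/cvgr0Pnorm_le => e e0.
(* Summed against the geometric series of ratio [q], this forcing contributes at most [e / 2]; the
   decaying initial value gets the other half. *)
have e2 : 0 < e * (1 - q) / 2 by rewrite divr_gt0 // mulr_gt0 // subr_gt0.
have [N _ NP] : \forall t \near \oo, a t.+1 <= q * a t + e * (1 - q) / 2.
  have b0' : \forall t \near \oo, `|b t| <= e * (1 - q) / 2.
    exact: cvgr0_norm_le b0 _ e2.
  near=> t; have bt : `|b t| <= e * (1 - q) / 2 by near: t.
  have := ler_norm (b t); have : a t.+1 <= q * a t + b t by near: t.
  lra.
have aN k : a (N + k)%N <= q ^+ k * a N + e / 2.
  elim: k => [|k IH]; first by rewrite addn0 expr0 mul1r ler_wpDr // divr_ge0 // ltW.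
  rewrite addnS exprS; apply: (le_trans (NP _ (leq_addr _ _))).
  by have := ler_wpM2l q0 IH; lra.
have [K _ KP] : \forall k \near \oo, q ^+ k * a N <= e / 2.
  have : q ^+ k * a N @[k --> \oo] --> 0 * a N.
    by apply: cvgM; [apply: cvg_expr; rewrite ger0_norm|exact: cvg_cst].
  rewrite mul0r => /cvgr0_norm_le /(_ (e / 2)) h; near=> k.
  by rewrite (le_trans (ler_norm _)) //; near: k; apply: h; rewrite divr_gt0.
exists (N + K)%N => // t /= NKt.
rewrite ger0_norm // -(subnKC (leq_trans (leq_addr _ _) NKt)).
apply: (le_trans (aN _)); have := KP (t - N)%N _; rewrite /= leq_subRL; last first.
  exact: leq_trans (leq_addr _ _) NKt.
by move=> /(_ NKt); lra.
Unshelve. all: by end_near. Qed.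

Local Notation normc := ComplexField.Normc.normc.

(* Induction on the roots: w = (F - r) v is killed by the remaining factors,
   and F^(k+1) v = r F^k v + F^k w. *)
Lemma power_cvg0_roots n (F : 'M[R[i]]_n.+1) (rs : seq R[i]) (v : 'cV_n.+1) :
  (forall r, r \in rs -> normc r < 1) ->
  horner_mx F (\prod_(r <- rs) ('X - r%:P)) *m v = 0 ->
  forall i, normc ((F ^+ k *m v) i 0) @[k --> \oo] --> (0 : R).
Proof.
elim: rs v => [|r rs IH] v rs1 /= Fv i.
  move: Fv; rewrite big_nil rmorph1 mul1mx => ->.
  under eq_fun do rewrite mulmx0 mxE ComplexField.Normc.normc0.
  exact: cvg_cst.
have {}IH := IH ((F - r%:M) *m v) _ _ i.
apply: (@cvg0_contraction (normc r) _
  (fun k => normc ((F ^+ k *m ((F - r%:M) *m v)) i 0))).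
- by rewrite rs1 ?mem_head // andbT; case: (r) => a b; rewrite sqrtr_ge0.
- by move=> k; case: (_ i 0) => a b; rewrite sqrtr_ge0.
- near=> k; rewrite -ComplexField.Normc.normcM.
  apply: le_trans (le_normcD _ _); rewrite exprSr -mulmxE -mulmxA.
  have -> : F ^+ k *m (F *m v) = r *: (F ^+ k *m v) + F ^+ k *m ((F - r%:M) *m v).
    by rewrite mulmxBl mulmxBr mul_scalar_mx -scalemxAr addrC subrK.
  rewrite [X in normc X <= _]mxE [X in normc (X + _)]mxE.
  exact: lexx.
- apply: IH => [s srs|]; first by rewrite rs1 // in_cons srs orbT.
  move: Fv; rewrite big_cons mulrC rmorphM /= rmorphB /= horner_mx_X horner_mx_C.
  by rewrite -mulmxE -mulmxA.
Unshelve. all: by end_near. Qed.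

(** Over the complex numbers the characteristic polynomial splits into factors at the eigenvalues,
    and by Cayley-Hamilton it kills every basis vector. *)
Lemma stable_power_cvg0 n (F : 'M[R]_n.+1) :
  stable F -> F ^+ k @[k --> \oo] --> (0 : 'M[R]_n.+1).
Proof.
move=> Fst; pose Fc := map_mx (real_complex R) F.
have [rs rsP] := closed_field_poly_normal (char_poly Fc).
move: rsP; rewrite (eqP (char_poly_monic Fc)) scale1r => rsP.
have eig z : (z \in rs) = eigenvalue Fc z.
  by rewrite eigenvalue_root_char rsP root_prod_XsubC.
have rs1 z : z \in rs -> normc z < 1.
  move=> zrs; apply: le_lt_trans Fst; apply: ub_le_sup; last first.
    by exists z => //=; rewrite -/Fc -eig.
  (* The supremum bounds its elements only if the set is bounded: the sum of all root moduli
     dominates each of them. *)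
  exists (\sum_(w <- rs) normc w) => _ [w /= + <-].
  rewrite -/Fc -eig => wrs.
  rewrite (big_rem w) //= ler_wpDr // sumr_ge0 // => u _.
  by case: u => a b; rewrite sqrtr_ge0.
apply/cvg_mxP => i j; rewrite mxE.
have := @power_cvg0_roots n Fc rs (delta_mx j 0) rs1.
rewrite -rsP Cayley_Hamilton mul0mx => /(_ erefl i) h.
apply/norm_cvg0P; apply: cvg_trans h; apply: near_eq_cvg; near=> k.
rewrite -colE mxE.
have -> : Fc ^+ k = map_mx (real_complex R) (F ^+ k) by rewrite rmorphXn.
by rewrite mxE /= expr0n /= addr0 sqrtr_sqr.
Unshelve. all: by end_near. Qed.

Lemma pdmx_lyapunov n (W F : 'M[R]_n) :
  psdmx W -> pdmx (W - F *m W *m F^T) -> pdmx W.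
Proof.
move=> W0 L0; rewrite -(subrK (F *m W *m F^T) W).
exact: pdmxD L0 (psdmx_congr F W0).
Qed.

Lemma stable_lyapunov n (F : 'M[R]_n) : stable F ->
  exists2 W : 'M[R]_n, pdmx W & pdmx (W - F *m W *m F^T).
Proof.
(* In dimension 0 there is no nonzero vector, so 0 is positive definite. *)
case: n F => [|n] F Fst.
  by exists 0; split=> [|x]; rewrite /symmx ?flatmx0 ?eqxx // flatmx0.
pose W N : 'M[R]_n.+1 := \sum_(k < N) F ^+ k *m (F ^+ k)^T.
(* The difference telescopes to the identity minus the last power. *)
have WL N : W N - F *m W N *m F^T = 1%:M - F ^+ N *m (F ^+ N)^T.
  elim: N => [|N IH].
    by rewrite /W big_ord0 mulmx0 mul0mx expr0 trmx1 mulmx1 !subrr.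
  rewrite /W big_ord_recr /= -/(W N) mulmxDr mulmxDl opprD addrACA IH.
  by rewrite exprS -mulmxE trmx_mul !mulmxA addrA subrK.
have Wpsd N : psdmx (W N).
  rewrite /W; elim: N => [|N [IHs IH0]].
    by rewrite big_ord0; split=> [|x]; [rewrite /symmx trmx0|rewrite mulmx0 mul0mx mxE].
  rewrite big_ord_recr /=; have [Gs G0] := psdmx_gram (F ^+ N).
  split=> [|x]; first by rewrite /symmx linearD /= IHs Gs.
  rewrite -/(bform _ x x) bformD; exact: addr_ge0 (IH0 x) (G0 x).
have : F ^+ N *m (F ^+ N)^T @[N --> \oo] --> (0 : 'M[R]_n.+1).
  rewrite -[X in _ --> X](mul0mx _ (0 : 'M[R]_n.+1)^T).
  by apply: cvg_mulmx; [|apply: cvg_trmx]; exact: stable_power_cvg0.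
(* Through [bform_le], the last power then costs at most half of [normsq x]. *)
have d0 : 0 < (4 * (n.+1 + n.+1)%:R)^-1 :> R by rewrite invr_gt0 mulr_gt0 // ltr0n.
move=> /cvgr0_norm_le /(_ _ d0) [N _ /(_ N (leqnn N)) NP].
suff L0 : pdmx (W N - F *m W N *m F^T).
  by exists (W N) => //; exact: pdmx_lyapunov L0.
rewrite WL; split; first by rewrite /symmx linearB /= trmx1 (psdmx_gram _).1.
move=> x /normsq_gt0 x0; rewrite -/(bform _ x x) bformB -/(normsq x).
have := le_trans (ler_norm _) (bform_le (F ^+ N *m (F ^+ N)^T) x x).
move: NP; rewrite -div1r ler_pdivlMr ?mulr_gt0 ?ltr0n // mulrCA.
set u := `|_| * _; move=> u1; nra.
Qed.

Lemma lyapunov_contraction n (W F : 'M[R]_n) :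
  pdmx W -> pdmx (W - F *m W *m F^T) ->
  exists2 q : R, 0 < q < 1 & forall x,
    bform W (F^T *m x) (F^T *m x) <= q * bform W x x.
Proof.
move=> Wpd Lpd.
have [q q01 [N _ /(_ N (leqnn N))]] := near_contraction Wpd Lpd (cvg_cst F : _ @ \oo --> _).
by exists q.
Qed.

Lemma bform_block_diag n k (U : 'M[R]_n) (V : 'M[R]_k) x y :
  bform (block_mx U 0 0 V) (col_mx x y) (col_mx x y) = bform U x x + bform V y y.
Proof.
rewrite /bform tr_col_mx mul_row_block !mulmx0 addr0 add0r mul_row_col.
by rewrite mxE.
Qed.

(** Nonnegativity of the form at [u - h *: v], divided by [h], bounds the cross term. *)
Lemma psd_young n (W : 'M[R]_n) (h : R) u v : pdmx W -> 0 < h ->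
  bform W (u + v) (u + v) <= (1 + h^-1) * bform W u u + (1 + h) * bform W v v.
Proof.
move=> Wpd h0; have := pdmx_ge0 (u - h *: v) Wpd.
rewrite -scaleNr !(bformDl, bformDr, bformZl, bformZr).
have -> : bform W v u = bform W u v by rewrite -bform_tr (pdmx_sym Wpd).
move=> H; suff : 2 * bform W u v <= h^-1 * bform W u u + h * bform W v v by lra.
rewrite -(ler_pM2l h0) mulrDr mulVKf ?gt_eqF //; nra.
Qed.

(* The weight s on the second block is small enough to absorb the coupling E. *)
Lemma block_lyapunov n k (W1 F1 : 'M[R]_n) (E : 'M[R]_(n, k)) (W2 F2 : 'M[R]_k) :
  pdmx W1 -> pdmx (W1 - F1 *m W1 *m F1^T) ->
  pdmx W2 -> pdmx (W2 - F2 *m W2 *m F2^T) ->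
  let F := block_mx F1 E 0 F2 in
  exists2 W : 'M[R]_(n + k), pdmx W & pdmx (W - F *m W *m F^T).
Proof.
move=> W1pd L1 W2pd L2 F.
have [q1 /andP[q10 q11] q1P] := lyapunov_contraction W1pd L1.
have [q2 /andP[q20 q21] q2P] := lyapunov_contraction W2pd L2.
have [e e0 eP] := pdmx_lower W1pd.
have [K K0 KP] := bform_upper (E *m W2 *m E^T).
(* Small enough that the Young factor keeps the second block contracting: [(1 + h) * q2 < 1]. *)
pose h : R := (1 - q2) / 2; have h0 : 0 < h by rewrite /h; lra.
pose K' : R := (1 + h^-1) * (K / e).
have K'0 : 0 < K' by rewrite mulr_gt0 ?divr_gt0 // addr_gt0 ?invr_gt0.
pose s : R := (1 - q1) / 2 / K'.
have s0 : 0 < s by rewrite divr_gt0 // divr_gt0 // subr_gt0.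
pose W := block_mx W1 0 0 (s *: W2).
have Ws : W^T = W.
  by rewrite /W tr_block_mx !trmx0 [(s *: W2)^T]linearZ /= (pdmx_sym W1pd) (pdmx_sym W2pd).
have Wx x y : bform W (col_mx x y) (col_mx x y) = bform W1 x x + s * bform W2 y y.
  by rewrite /W bform_block_diag bformZ.
have W0 : psdmx W.
  split=> // z; rewrite -(vsubmxK z) -/(bform W _ _) Wx.
  apply: addr_ge0; first exact: pdmx_ge0.
  by apply: mulr_ge0; [exact: ltW|exact: pdmx_ge0].
suff L0 : pdmx (W - F *m W *m F^T) by exists W => //; exact: pdmx_lyapunov L0.
split; first by rewrite /symmx linearB /= !trmx_mul trmxK Ws mulmxA.
move=> z z0; rewrite -/(bform _ z z) bformB bform_mul -(vsubmxK z).
set x := usubmx z; set y := dsubmx z.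
rewrite tr_block_mx trmx0 mul_block_col mul0mx addr0 !Wx.
have x0 := pdmx_ge0 x W1pd; have y0 := pdmx_ge0 y W2pd.
have xy0 : 0 < bform W1 x x \/ 0 < bform W2 y y.
  have [x00|xn0] := eqVneq x 0; [right|left; exact: W1pd.2].
  apply: W2pd.2; apply: contra_neq z0 => y00.
  by rewrite -(vsubmxK z) -/x -/y x00 y00 col_mx0.
have Y := psd_young (E^T *m x) (F2^T *m y) W2pd h0.
have Ex : bform W2 (E^T *m x) (E^T *m x) <= K / e * bform W1 x x.
  rewrite -bform_mul; apply: (le_trans (KP x)).
  by rewrite -mulrA ler_pM2l // ler_pdivlMl.
have C1 : (1 + h^-1) * bform W2 (E^T *m x) (E^T *m x) <= K' * bform W1 x x.
  by rewrite /K' -[leRHS]mulrA ler_pM2l // addr_gt0 ?invr_gt0.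
have C2 := q2P y; have C3 := q1P x.
have C4 : (1 + h) * bform W2 (F2^T *m y) (F2^T *m y) <=
          (1 + h) * (q2 * bform W2 y y) by rewrite ler_pM2l // addr_gt0.
have C5 : s * (K' * bform W1 x x) = (1 - q1) / 2 * bform W1 x x.
  by rewrite mulrA /s mulfVK ?gt_eqF.
have C6 : (1 + h) * q2 < 1 by rewrite /h; nra.
have := ler_wpM2l (ltW s0) (le_trans Y (lerD C1 C4)).
rewrite mulrDr C5.
set u := bform W2 (E^T *m x + _) _; set w1 := bform W1 x x in x0 xy0 *.
set w2 := bform W2 y y in y0 xy0 *; set w3 := bform W1 _ _.
move=> D.
have : 0 < (1 - q1) / 2 * w1 + s * ((1 - (1 + h) * q2) * w2).
  have a0 : 0 < (1 - q1) / 2 by lra.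
  have b0 : 0 < 1 - (1 + h) * q2 by lra.
  case: xy0 => w0; [apply: ltr_pwDl|apply: ltr_wpDl].
  - exact: mulr_gt0.
  - by rewrite mulr_ge0 ?(ltW s0) // mulr_ge0 // ltW.
  - by rewrite mulr_ge0 // ltW.
  - by rewrite mulr_gt0 // mulr_gt0.
move: C3; rewrite -/w1 -/w3 => C3; lra.
Qed.

End LyapunovInequality.

(** * Lyapunov recursions with convergent coefficients *)

Section LyapunovIteration.
Variables (R : realType) (n : nat).
Implicit Types (W F E : 'M[R]_n).

(** An upper bound [e] on the size of [E] relative to [W], free of division; independent [x] and [y]
    suit a non-symmetric [E]. *)
Let bounded_by W E (e : R) :=
  forall x y, `|bform E x y| <= e * (bform W x x + bform W y y).

Lemma bounded_by_norm W : pdmx W ->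
  exists2 k : R, 0 <= k & forall E, bounded_by W E (k * `|E|).
Proof.
move=> Wpd; have [e e0 eP] := pdmx_lower Wpd.
exists ((n + n)%:R / e) => [|E x y]; first by rewrite divr_ge0 // ltW.
apply: (le_trans (bform_le E x y)).
rewrite [_ / e * _]mulrAC [_ * `|E|]mulrC -[leRHS]mulrA ler_wpM2l ?mulr_ge0 //.
by rewrite ler_pdivlMl // mulrDr lerD.
Qed.

Lemma bounded_by_congr W F E (q e : R) : 0 <= e ->
  (forall x, bform W (F^T *m x) (F^T *m x) <= q * bform W x x) ->
  bounded_by W E e -> bounded_by W (F *m E *m F^T) (q * e).
Proof.
move=> e0 FW EW x y; rewrite bform_mul; apply: (le_trans (EW _ _)).
by rewrite [q * e]mulrC -mulrA ler_wpM2l // mulrDr lerD.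
Qed.

(** A scalar sequence [e] majorises the size of [E_] and eventually contracts, with a forcing
    proportional to the norm of [Q_]. *)
Lemma perturbed_contraction_cvg0 W F (F_ E_ Q_ : nat -> 'M[R]_n) :
  pdmx W -> pdmx (W - F *m W *m F^T) -> F_ @ \oo --> F ->
  (forall t, E_ t.+1 = F_ t *m E_ t *m (F_ t)^T + Q_ t) ->
  Q_ @ \oo --> (0 : 'M[R]_n) -> E_ @ \oo --> (0 : 'M[R]_n).
Proof.
move=> Wpd Lpd FF EE Q0.
have [q /andP[q0 q1] [N _ NP]] := near_contraction Wpd Lpd FF.
have [k k0 kP] := bounded_by_norm Wpd.
(* Up to time [N] no contraction is guaranteed, so [e] is read off the norm of [E_]; the recursion
   takes over afterwards. *)
pose e := fix e t : R := if t is t'.+1 then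
    if (t' < N)%N then k * `|E_ t'.+1| else q * e t' + k * `|Q_ t'|
  else k * `|E_ 0%N|.
have e0 t : 0 <= e t.
  elim: t => [|t IH] /=; first exact: mulr_ge0.
  by case: ifP => _; rewrite ?addr_ge0 ?mulr_ge0 // ltW.
have Ee t : bounded_by W (E_ t) (e t).
  elim: t => [|t IH] /=; first exact: kP.
  case: ltnP => tN; first exact: kP.
  rewrite EE => x y; rewrite bformD mulrDl; apply: (le_trans (ler_normD _ _)).
  by apply: lerD; [exact: (bounded_by_congr (e0 t) (NP t tN) IH)|exact: kP].
have ecvg : e @ \oo --> (0 : R).
  apply: (@cvg0_contraction _ q _ (fun t => k * `|Q_ t|)) => //.
  - by rewrite (ltW q0).
  - by exists N => // t /= Nt; rewrite ltnNge Nt.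
  - rewrite -(mulr0 k); apply: cvgM; first exact: cvg_cst.
    by rewrite -(normr0 'M[R]_n); exact: cvg_norm.
apply/cvg_mxP => i j; rewrite mxE.
pose C := bform W (delta_mx i 0) (delta_mx i 0) +
          bform W (delta_mx j 0) (delta_mx j 0).
have : e t * C @[t --> \oo] --> 0 * C by apply: cvgM => //; exact: cvg_cst.
rewrite mul0r => eC; apply/cvgr0Pnorm_le => d d0.
have : \forall t \near \oo, `|e t * C| <= d by exact: cvgr0_norm_le eC _ d0.
apply: filterS => t; apply: le_trans.
by rewrite -bform_delta (le_trans (Ee t _ _)) // ler_norm.
Qed.

(* X - F X F^T is injective in X, hence onto by finite dimensionality. *)
Lemma lyapunov_solvable W F E :
  pdmx W -> pdmx (W - F *m W *m F^T) ->
  exists X : 'M[R]_n, unique (fun X => X = F *m X *m F^T + E) X.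
Proof.
move=> Wpd Lpd.
have inj X : X = F *m X *m F^T -> X = 0.
  (* The constant sequence [X] solves the unforced recursion, hence tends to 0. *)
  move=> XF; have cF : (fun=> F) @ \oo --> F by exact: cvg_cst.
  have c0 : (fun=> 0) @ \oo --> (0 : 'M[R]_n) by exact: cvg_cst.
  have cX : (fun=> X) @ \oo --> X by exact: cvg_cst.
  apply: (cvg_unique (@norm_hausdorff _ _) cX).
  apply: (@perturbed_contraction_cvg0 W F (fun=> F) (fun=> X) (fun=> 0)) => //.
  by move=> _; rewrite addr0.
pose f := idfun \- (mulmxr F^T \o mulmx F) : 'M[R]_n -> 'M[R]_n.
have fK : lker (linfun f) == 0%VS.
  apply/lker0P => X Y; rewrite !lfunE /= /f /=.
  move=> XY; apply/eqP; rewrite -subr_eq0; apply/eqP/inj.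
  rewrite mulmxBr mulmxBl -{1}[X](subrK (F *m X *m F^T)) XY.
  by rewrite -addrA addrC addrA subrK.
have /memv_imgP [X _ XE] : E \in limg (linfun f) by rewrite lker0_limgf ?memvf.
move: XE; rewrite lfunE /= /f /= => XE.
have XX : X = F *m X *m F^T + E by rewrite XE addrC subrK.
exists X; split=> // Y YY; apply/eqP; rewrite -subr_eq0; apply/eqP/inj.
by rewrite {1}XX {1}YY opprD addrACA subrr addr0 mulmxBr mulmxBl.
Qed.

Lemma lyapunov_iteration_cvg m W F (M : 'M[R]_(n, m)) (F_ Pi_ : nat -> 'M[R]_n)
    (M_ : nat -> 'M[R]_(n, m)) :
  pdmx W -> pdmx (W - F *m W *m F^T) ->
  F_ @ \oo --> F -> M_ @ \oo --> M ->
  (forall t, Pi_ t.+1 = F_ t *m Pi_ t *m (F_ t)^T + M_ t *m (M_ t)^T) ->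
  exists2 Pi : 'M[R]_n, unique (fun X => X = F *m X *m F^T + M *m M^T) Pi &
    Pi_ @ \oo --> Pi.
Proof.
move=> Wpd Lpd FF MM PP.
have [X [XX Xu]] := lyapunov_solvable (M *m M^T) Wpd Lpd.
exists X => //.
(* The residual of [X] in the equation at time [t]; it is the forcing in the recursion of the error
   [Pi_ t - X]. *)
pose Q t := (F_ t *m X *m (F_ t)^T + M_ t *m (M_ t)^T) - X.
have Q0 : Q @ \oo --> (0 : 'M[R]_n).
  rewrite -(subrr X); apply: cvgB; last exact: cvg_cst.
  rewrite [X in _ --> X]XX; apply: cvgD; apply: cvg_mulmx => //; try exact: cvg_trmx.
  by apply: cvg_mulmx => //; exact: cvg_cst.
have := @perturbed_contraction_cvg0 W F F_ (fun t => Pi_ t - X) Q Wpd Lpd FF _ Q0.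
move=> h; have : Pi_ t - X @[t --> \oo] --> (0 : 'M[R]_n).
  apply: h => t; rewrite PP /Q mulmxBr mulmxBl.
  by rewrite addrA addrA subrK.
by move=> /subr_cvg0.
Qed.

End LyapunovIteration.

(** * Inequalities between log-determinant and trace *)

Section LogDet.
Variable R : realType.

Lemma ln_le_subr1 (x : R) : 0 < x -> ln x <= x - 1.
Proof.
by move=> x0; rewrite -{1}[x](subrK 1) addrC le_ln1Dx // ltrBrDr addNr.
Qed.

(* Block elimination: T N T^T = diag(N_00, S), with S the Schur complement. *)
Lemma pdmx_schur n (N : 'M[R]_(1 + n)) : pdmx N ->
  exists S : 'M[R]_n, [/\ pdmx S, 0 < N 0 0, \det N = N 0 0 * \det S &
    \tr S <= \tr N - N 0 0].
Proof.
move=> Npd; have Ns := pdmx_sym Npd.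
have a0 : 0 < N 0 0.
  rewrite -bform_delta; apply: Npd.2; apply/negP => /eqP/matrixP/(_ 0 0)/eqP.
  by rewrite !mxE eqxx oner_eq0.
set a := N 0 0 in a0 *; pose v := dlsubmx N.
have NE : N = block_mx a%:M v^T v (drsubmx N).
  rewrite -{1}[N]submxK; congr block_mx.
    rewrite [LHS]mx11_scalar; congr (_%:M); rewrite !mxE; congr (N _ _); exact: val_inj.
  by rewrite -{1}Ns /v -trmx_dlsub.
pose S := drsubmx N - a^-1 *: (v *m v^T).
pose T : 'M[R]_(1 + n) := block_mx 1%:M 0 (- a^-1 *: v) 1%:M.
have detT : \det T = 1 by rewrite det_lblock !det1 mulr1.
have TNT : T *m N *m T^T = block_mx a%:M 0 0 S.
  rewrite NE /T tr_block_mx !mulmx_block !trmx0 !trmx1 !mul0mx !mul1mx !mulmx0 !mulmx1.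
  rewrite !addr0 linearZ /= -!scalemxAl -!scalemxAr mul_mx_scalar mul_scalar_mx.
  rewrite !scalerA mulNr mulVf ?gt_eqF // !scaleN1r !addNr.
  by rewrite mul0mx scaler0 add0r scaleNr addrC.
have Bpd : pdmx (T *m N *m T^T).
  have [Bs _] := psdmx_congr T (pdmx_psd Npd); split=> // x x0.
  rewrite -/(bform _ x x) bform_mul; apply: Npd.2; apply: contra_neq x0 => Tx0.
  have Tu : T^T \in unitmx by rewrite unitmx_tr unitmxE detT unitr1.
  by rewrite -(mulKmx Tu x) Tx0 mulmx0.
rewrite TNT in Bpd.
exists S; split=> //.
- split.
    have := pdmx_sym Bpd; rewrite tr_block_mx => /eq_block_mx [_ _ _]; exact.
  move=> y y0; have := Bpd.2 (col_mx 0 y); rewrite -/(bform _ _ _) bform_block_diag.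
  rewrite [bform a%:M _ _]/bform mulmx0 mxE add0r; apply.
  by apply: contra_neq y0 => /(congr1 dsubmx); rewrite col_mxKd => ->; exact: linear0.
- have := congr1 determinant TNT.
  by rewrite !det_mulmx det_tr detT mul1r mulr1 det_ublock det_scalar1.
- have -> : \tr N = a + \tr (drsubmx N).
    by rewrite {1}NE mxtrace_block mxtrace_scalar mulr1n.
  rewrite /S linearB linearZ /= addrAC subrr add0r gerBl.
  apply: mulr_ge0; first by rewrite invr_ge0 ltW.
  by apply: sumr_ge0 => i _; rewrite -bform_delta; exact: (psdmx_gram v).2.
Qed.

(** Passing to a Schur complement factors the determinant and can only lower the remaining trace, so
    the scalar bound [ln x <= x - 1] is used once per dimension. *)
Lemma pdmx_ln_det n (N : 'M[R]_n) : pdmx N ->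
  0 < \det N /\ ln (\det N) <= \tr N - n%:R.
Proof.
elim: n N => [|n IH] N Npd; first by rewrite det_mx00 ln1 /mxtrace big_ord0 subrr.
have [S [Spd a0 detN trS]] := @pdmx_schur n N Npd.
have [S0 lnS] := IH S Spd.
rewrite detN; split; first exact: mulr_gt0.
rewrite lnM ?posrE // -natr1; have := ln_le_subr1 a0; lra.
Qed.

(** For [1 <= x <= y], ln y - ln x = ln (y / x) <= y / x - 1 <= y - x. *)
Lemma subr_ln_mono (x y : R) : 1 <= x -> x <= y -> x - ln x <= y - ln y.
Proof.
move=> x1 xy; have x0 : 0 < x by lra.
have y0 : 0 < y by lra.
have z0 : 0 < y / x by rewrite divr_gt0.
have : ln y = ln x + ln (y / x) by rewrite -lnM ?posrE // mulrC mulfVK ?gt_eqF.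
have := ln_le_subr1 z0.
have : y / x - 1 <= y - x.
  rewrite -[X in _ - X](@divff _ x) ?gt_eqF // -mulrBl ler_pdivrMr //; nra.
lra.
Qed.

(** In terms of [N = invmx M], eliminating the first coordinate leaves at least
    [N 0 0 - 1 - ln (N 0 0)], which is increasing beyond 1, and [N 0 0 >= 1 + y]. *)
Lemma ln_det_trace_lower n (M : 'M[R]_n.+1) (y : R) : pdmx M -> 0 <= y ->
  M 0 0 * (1 + y) <= 1 ->
  y - ln (1 + y) <= ln (\det M) + \tr (invmx M) - n.+1%:R.
Proof.
move=> Mpd y0 My; have Npd := pdmxV Mpd; set N := invmx M in Npd *.
have [S [Spd N0 detN trS]] := @pdmx_schur n N Npd.
have [S0 lnS] := pdmx_ln_det Spd.
have lnM : ln (\det M) = - (ln (N 0 0) + ln (\det S)).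
  have -> : \det M = (\det N)^-1 by rewrite /N det_inv invrK.
  by rewrite lnV ?posrE detN ?mulr_gt0 // lnM ?posrE.
have [S1 [_ M0 _ _]] := @pdmx_schur n M Mpd.
(* The Fenchel inequality at the best multiple of the first basis vector. *)
have NM : 1 <= M 0 0 * N 0 0.
  have := pdmx_fenchel ((M 0 0)^-1 *: delta_mx 0 0) (delta_mx 0 0) Mpd.
  rewrite !(bformZl, bformZr) !bform_delta mxE eqxx mulr1 mulVf ?gt_eqF // mulr1.
  move=> H; have : (M 0 0)^-1 <= N 0 0 by lra.
  by rewrite -div1r ler_pdivrMr // mulrC.
have yN : 1 + y <= N 0 0 by rewrite -(ler_pM2l M0); apply: le_trans NM.
have := @subr_ln_mono (1 + y) (N 0 0) _ yN; rewrite lnM -natr1 => /(_ ltac:(lra)).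
lra.
Qed.

Lemma subr_ln1D_gt0 (y : R) : 0 < y -> 0 < y - ln (1 + y).
Proof.
move=> y0; rewrite subr_gt0 -ltr_expR lnK ?posrE ?addr_gt0 //.
by rewrite expR_gt1Dx // gt_eqF.
Qed.

End LogDet.

(** * The observation model and its Riccati equation *)

Section FilterModel.
Variables (R : realType) (n p : nat).
Variables (A : 'M[R]_n) (B : 'M[R]_(n, n + p)).
Variables (C : 'M[R]_(p, n)) (D : 'M[R]_(p, n + p)).
Hypothesis model : filter_model A B C D.

Lemma gram_pdmx m k (S : 'M[R]_(m, k)) :
  (forall x : 'cV_m, S^T *m x = 0 -> x = 0) -> pdmx (S *m S^T).
Proof.
move=> Sinj; split=> [|x x0]; first exact: (psdmx_gram S).1.
rewrite -/(bform _ x x) -[S in S *m _]mulmx1 bform_mul.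
by apply: normsq_gt0; apply: contra_neq x0 => /Sinj.
Qed.

(** Injectivity of the transposed stacked matrix; it makes both B B^T and D D^T positive
    definite. *)
Lemma stacked_inj (x : 'cV[R]_n) (y : 'cV_p) :
  B^T *m x + D^T *m y = 0 -> x = 0 /\ y = 0.
Proof.
have [_ _ _ BDu] := model; move=> xy.
have : (col_mx B D)^T *m col_mx x y = 0 by rewrite tr_col_mx mul_row_col.
rewrite -unitmx_tr in BDu => /(congr1 (mulmx (invmx (col_mx B D)^T))).
rewrite mulKmx // mulmx0 => xy0; split.
  by have := congr1 usubmx xy0; rewrite col_mxKu linear0.
by have := congr1 dsubmx xy0; rewrite col_mxKd linear0.
Qed.

Lemma BBt_pdmx : pdmx (B *m B^T).
Proof.
apply: gram_pdmx => x Bx.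
by have [] := @stacked_inj x 0; rewrite // Bx mulmx0 addr0.
Qed.

Lemma DDt_pdmx : pdmx (D *m D^T).
Proof.
apply: gram_pdmx => y Dy.
by have [] := @stacked_inj 0 y; rewrite // Dy mulmx0 addr0.
Qed.

Lemma innovation_pdmx (V : 'M[R]_n) : pdmx V -> pdmx (C *m V *m C^T + D *m D^T).
Proof.
move=> Vpd; rewrite addrC; apply: pdmxD; first exact: DDt_pdmx.
exact/psdmx_congr/pdmx_psd.
Qed.

Lemma cvg_gain {T} {F : set_system T} {FF : Filter F} (V_ : T -> 'M[R]_n) V :
  pdmx V -> V_ t @[t --> F] --> (V : 'M[R]_n) ->
  gain A C D (V_ t) @[t --> F] --> gain A C D V.
Proof.
move=> Vpd VV; rewrite /gain.
have cc k l (S : 'M[R]_(k, l)) : (fun _ : T => S) @ F --> S by exact: cvg_cst.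
apply: cvg_mulmx; first by do 2 apply: cvg_mulmx => //.
apply: cvg_invmx; first exact: (pdmx_unit (innovation_pdmx Vpd)).
by apply: cvgD => //; do 2 apply: cvg_mulmx => //.
Qed.

(** A lower bound on [P] independent of [th], which later forces theta to 0. *)
Lemma riccati_geBBt th P : riccati_solution A B C D th P -> psdmx (P - B *m B^T).
Proof.
move=> [Ppd Vpd ->]; rewrite addrK.
apply/psdmx_congr/pdmx_psd/pdmxV/pdmxD => //.
rewrite -{2}[C]trmxK; apply: psdmx_congr.
exact/pdmx_psd/pdmxV/DDt_pdmx.
Qed.

(* Joseph's form of the Riccati equation:
   P = Abar P Abar^T + Bbar Bbar^T, with Bbar Bbar^T >= B B^T > 0. *)
Lemma kalman_lyapunov P : riccati_solution A B C D 0 P ->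
  let Ab := Abar A C (gain A C D (risk_V P 0)) in
  pdmx (P - Ab *m P *m Ab^T).
Proof.
move=> [Ppd _ PE] Ab.
have Pu := pdmx_unit Ppd; have Ru := pdmx_unit DDt_pdmx.
have V0 : risk_V P 0 = P by rewrite /risk_V -scalemx1 scale0r subr0 invmxK.
rewrite /Ab V0 {Ab V0}.
pose S := C *m P *m C^T + D *m D^T.
have Su : S \in unitmx := pdmx_unit (innovation_pdmx Ppd).
(* [U] is the gain without its factor [A], and [N] is the matrix inversion lemma's form of (P^-1 +
   C^T (D D^T)^-1 C)^-1, as checked in [NE]. *)
pose U := P *m C^T *m invmx S; pose N := P - U *m C *m P.
have GE : gain A C D P = A *m U by rewrite /gain -/S /U !mulmxA.
have NC : N *m C^T = U *m (D *m D^T).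
  have -> : D *m D^T = S - C *m P *m C^T by rewrite /S addrC addKr.
  by rewrite mulmxBl mulmxBr mulmxKV // !mulmxA.
have NE : invmx (invmx P - 0%:M + C^T *m invmx (D *m D^T) *m C) = N.
  rewrite -[0%:M]scalemx1 scale0r subr0; set Q := _ + _.
  have NQ : N *m Q = 1%:M.
    rewrite mulmxDr !mulmxA NC mulmxK // mulmxBl mulmxV // mulmxK //.
    exact: subrK.
  have [_ Qu] := mulmx1_unit NQ.
  by rewrite -[LHS]mul1mx -NQ mulmxK.
(* Here Abar P = A N, and N C^T = U D D^T turns the cross term into G D D^T G^T. *)
have AbE : Abar A C (gain A C D P) *m P *m (Abar A C (gain A C D P))^T =
    A *m N *m A^T - gain A C D P *m (D *m D^T) *m (gain A C D P)^T.
  have -> : Abar A C (gain A C D P) *m P = A *m N.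
    by rewrite /Abar /N GE mulmxBl mulmxBr !mulmxA.
  rewrite /Abar [(A - _)^T]linearB /= trmx_mul mulmxBr; congr (_ - _).
  by rewrite [LHS]mulmxA -(mulmxA A N) NC GE !mulmxA.
rewrite AbE {1}PE NE opprB addrC addrA subrK addrC.
exact/pdmxD/psdmx_congr/pdmx_psd/DDt_pdmx/BBt_pdmx.
Qed.

End FilterModel.

(** * Equations satisfied by the filter limits, and theta for small tolerance *)

Section SmallTolerance.
Variables (R : realType) (n p : nat).

(** P^-1 >= (th + e) I inverts to th P <= th / (th + e) I, strictly below the identity. *)
Lemma one_minus_pdmx (P : 'M[R]_n) (th : R) : 0 < th ->
  pdmx P -> pdmx (invmx P - th%:M) -> pdmx (1%:M - th *: P).
Proof.
move=> th0 Ppd Vpd; have [e e0 eP] := pdmx_lower Vpd.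
have the : 0 < th + e by rewrite addr_gt0.
have Ple x : bform P x x <= (th + e)^-1 * normsq x.
  have := @pdmxV_antitone _ n (th + e)%:M (invmx P) (pdmx_scalar n the) (pdmxV Ppd).
  rewrite (invmxK P) invmx_scalar => /(_ _ x); rewrite !bform_scalar; apply => y.
  by have := eP y; rewrite bformB !bform_scalar; lra.
split; first by rewrite /symmx linearB linearZ /= tr_scalar_mx (pdmx_sym Ppd).
move=> x /normsq_gt0 x0; rewrite -/(bform _ x x) bformB bformZ -/(normsq x).
have := ler_wpM2l (ltW th0) (Ple x); rewrite mulrA.
have : th * (th + e)^-1 < 1 by rewrite ltr_pdivrMr // mul1r ltrDl.
nra.
Qed.

Variables (A : 'M[R]_n) (B : 'M[R]_(n, n + p)).
Variables (C : 'M[R]_(p, n)) (D : 'M[R]_(p, n + p)).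
Variables (cmax : R) (theta : R -> R) (P V : R -> 'M[R]_n) (G : R -> 'M[R]_(n, p)).
Hypothesis model : filter_model A B C D.
Hypothesis limits : filter_limits A B C D cmax theta P V G.

(** The equations for [V c], [G c] and [c] are limits of the filter relations started at the
    identity; [risk_gamma] is continuous at the limit because [1%:M - theta c *: P c] is positive
    definite. *)
Lemma filter_limits_eqs c : 0 < c <= cmax ->
  [/\ riccati_solution A B C D (theta c) (P c), 0 < theta c,
      V c = risk_V (P c) (theta c), G c = gain A C D (V c) &
      c = risk_gamma (P c) (theta c)].
Proof.
move=> /limits [+ [Ppd th0 Vpd] _ [Psol _]].
move=> /(_ 1%:M (pdmx_scalar n ltr01)) [P_ [V_ [th_ [G_ [flt]]]]].
move=> [PP VV thth GG]; case: flt => _ _ GE _ thE VE.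
have [_ Wpd _] := Psol.
have P1 : P_ t.+1 @[t --> \oo] --> P c by rewrite (cvg_shiftS P_).
have I1 : invmx (P_ t.+1) - (th_ t)%:M @[t --> \oo] --> invmx (P c) - (theta c)%:M.
  apply: cvgB; first exact: cvg_invmx (pdmx_unit Ppd) P1.
  exact: cvg_scalar_mx.
have V1 : V_ t.+1 @[t --> \oo] --> V c by rewrite (cvg_shiftS V_).
have V2 : V_ t.+1 @[t --> \oo] --> risk_V (P c) (theta c).
  by under eq_fun do rewrite VE; exact: cvg_invmx (pdmx_unit Wpd) I1.
have G2 : G_ @ \oo --> gain A C D (V c).
  rewrite (_ : G_ = fun t => gain A C D (V_ t)); first exact: (cvg_gain model Vpd VV).
  exact/funext.
split=> //.
- exact: (cvg_unique (@norm_hausdorff _ _) V1 V2).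
- exact: (cvg_unique (@norm_hausdorff _ _) GG G2).
- have Mpd := one_minus_pdmx th0 Ppd Wpd.
  have M1 : 1%:M - th_ t *: P_ t.+1 @[t --> \oo] --> 1%:M - theta c *: P c.
    by apply: cvgB; [exact: cvg_cst|exact: cvgZ].
  have g1 : risk_gamma (P_ t.+1) (th_ t) @[t --> \oo] --> risk_gamma (P c) (theta c).
    apply: cvgM; first exact: cvg_cst.
    apply: cvgB; last exact: cvg_cst.
    apply: cvgD.
      apply: (cvg_comp _ _ (cvg_det M1)); apply: continuous_ln.
      by have [] := pdmx_ln_det Mpd.
    apply: cvg_bigsum => i.
    have : invmx (1%:M - th_ t *: P_ t.+1) @[t --> \oo] -->
           invmx (1%:M - theta c *: P c) by exact: cvg_invmx (pdmx_unit Mpd) M1.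
    by move=> /cvg_mxP; exact.
  have g2 : risk_gamma (P_ t.+1) (th_ t) @[t --> \oo] --> c.
    rewrite (_ : (fun t => _) = cst c); first exact: cvg_cst.
    by apply/funext => t /=; have [[_ _ <-] _] := thE t.
  exact: (cvg_unique (@norm_hausdorff _ _) g2 g1).
Qed.

End SmallTolerance.

Lemma theta_cvg0 (R : realType) n p (A : 'M[R]_n.+1) (B : 'M[R]_(n.+1, n.+1 + p))
    (C : 'M[R]_(p, n.+1)) (D : 'M[R]_(p, n.+1 + p)) (cmax : R)
    (theta : R -> R) (P V : R -> 'M[R]_n.+1) (G : R -> 'M[R]_(n.+1, p)) :
  filter_model A B C D -> 0 < cmax ->
  filter_limits A B C D cmax theta P V G -> theta c @[c --> 0^'+] --> 0.
Proof.
move=> model cmax0 limits.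
have b0 : 0 < (B *m B^T) 0 0.
  have [_] := BBt_pdmx model; rewrite -bform_delta; apply.
  by apply/negP => /eqP/matrixP/(_ 0 0)/eqP; rewrite !mxE eqxx oner_eq0.
set b := (B *m B^T) 0 0 in b0.
apply/cvgr0Pnorm_le => d d0.
have db0 : 0 < d * b by exact: mulr_gt0.
(* The lower bound on the risk when [theta c] exceeds [d]; the half is the prefactor of
   [risk_gamma]. *)
pose c1 := (d * b - ln (1 + d * b)) / 2.
have c10 : 0 < c1 by rewrite divr_gt0 // subr_ln1D_gt0.
near=> c.
have c0 : 0 < c by near: c; exact: nbhs_right_gt.
have cm : c <= cmax by near: c; exact: nbhs_right_le.
have cc1 : c < c1 by near: c; exact: nbhs_right_lt.
have /(filter_limits_eqs model limits) [sol th0 _ _ cE] : 0 < c <= cmax by rewrite c0.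
rewrite gtr0_norm // leNgt; apply/negP => dth.
have [Ppd Wpd _] := sol.
have Mpd := one_minus_pdmx th0 Ppd Wpd.
have bP : b <= P c 0 0.
  have := (riccati_geBBt model sol).2 (delta_mx 0 0).
  by rewrite -/(bform _ _ _) bformB !bform_delta subr_ge0.
have y0 : 0 < theta c * b by exact: mulr_gt0.
have tP : theta c * b <= theta c * P c 0 0 by rewrite ler_pM2l.
have := @ln_det_trace_lower R n _ (theta c * b) Mpd (ltW y0).
(* With [y = theta c * b] the diagonal entry is at most [1 - y], and [(1 - y) * (1 + y) <= 1]. *)
rewrite !mxE eqxx mulr1n => /(_ ltac:(nra)).
have dy : 1 + d * b <= 1 + theta c * b by rewrite lerD2l ler_pM2r // ltW.
have := subr_ln_mono _ dy => /(_ ltac:(lra)).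
move: cE; rewrite /risk_gamma /c1 in cc1 *; lra.
Unshelve. all: by end_near. Qed.

(** * Limits of Abar and Bbar as the tolerance vanishes *)

Section BarLimits.
Variables (R : realType) (n p : nat).
Variables (A : 'M[R]_n) (B : 'M[R]_(n, n + p)).
Variables (C : 'M[R]_(p, n)) (D : 'M[R]_(p, n + p)).
Variables (cmax : R) (theta : R -> R) (P V : R -> 'M[R]_n) (G : R -> 'M[R]_(n, p)).

(** Uniqueness of the Riccati solution identifies the family [Q] behind the continuity assumption,
    taken at [theta c], with [P c]. *)
Lemma bar_cvg : filter_model A B C D -> 0 < cmax ->
  filter_limits A B C D cmax theta P V G -> theta c @[c --> 0^'+] --> 0 ->
  bar_continuity A B C D ->
  exists2 Q : 'M[R]_n, riccati_solution A B C D 0 Q &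
    Abar A C (G c) @[c --> 0^'+] --> Abar A C (gain A C D (risk_V Q 0)) /\
    Bbar B D (G c) @[c --> 0^'+] --> Bbar B D (gain A C D (risk_V Q 0)).
Proof.
move=> model cmax0 limits th0 [m m0 [Q Qsol Qcont]].
have m00 : (0 : R) <= 0 <= m by apply/andP; split; [exact: lexx|exact: ltW].
exists (Q 0); first by have [] := Qsol 0 m00.
pose f th := (Abar A C (gain A C D (risk_V (Q th) th)),
              Bbar B D (gain A C D (risk_V (Q th) th))).
have small : \forall c \near 0^'+, 0 < c <= cmax /\ 0 <= theta c <= m.
  near=> c.
  have cc : 0 < c <= cmax.
    by apply/andP; split; near: c; [exact: nbhs_right_gt|exact: nbhs_right_le].
  split=> //; have [_ t0 _ _ _] := filter_limits_eqs model limits cc.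
  by rewrite (ltW t0) /=; near: c; exact: cvgr_le th0 _ m0.
have f0 : f (theta c) @[c --> 0^'+] --> f 0.
  have := (subspace_continuousP _ _).1 Qcont 0; rewrite /= in_itv /= => /(_ m00) fw.
  (* Continuity holds only relative to [[0, m]], so [theta c] must approach 0 inside that
     interval. *)
  have thw : theta c @[c --> 0^'+] --> within `[0, m] (nbhs (0 : R)).
    move=> S; rewrite /within /= => S0.
    have := th0 _ S0; apply: filterS2 small => c [_ tm] /=; apply.
    by rewrite /= in_itv.
  exact: (cvg_comp _ _ thw fw).
have fE : \forall c \near 0^'+, f (theta c) = (Abar A C (G c), Bbar B D (G c)).
  apply: filterS small => c [cc tm].
  have [sol _ VE GE _] := filter_limits_eqs model limits cc.
  rewrite /f; have -> : Q (theta c) = P c by have [_] := Qsol _ tm; apply.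
  by rewrite -VE -GE.
have fG : (Abar A C (G c), Bbar B D (G c)) @[c --> 0^'+] --> f 0.
  by apply: cvg_trans f0; apply: near_eq_cvg; apply: filterS fE => c ->.
split.
  exact: (cvg_comp _ _ fG (@cvg_fst _ _ _ _ _)).
exact: (cvg_comp _ _ fG (@cvg_snd _ _ _ _ _)).
Unshelve. all: by end_near. Qed.

End BarLimits.

(** * The backward recursion and the closed-loop matrix *)

Section BackwardRecursion.
Variables (R : realType) (n p : nat).
Variables (A : 'M[R]_n) (B : 'M[R]_(n, n + p)).
Variables (C : 'M[R]_(p, n)) (D : 'M[R]_(p, n + p)).

Lemma pdmxZ (W : 'M[R]_n) (a : R) : 0 < a -> pdmx W -> pdmx (a *: W).
Proof.
move=> a0 [Ws W0]; split; first by rewrite /symmx linearZ /= Ws.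
by move=> x x0; rewrite -/(bform _ x x) bformZ mulr_gt0 //; exact: W0.
Qed.

(** Nonnegativity at [x + y] and [x - y] bounds even twice the left side. *)
Lemma psd_bform_le (X : 'M[R]_n) x y : pdmx X ->
  `|bform X x y| <= bform X x x + bform X y y.
Proof.
move=> Xpd; have := pdmx_ge0 (x + y) Xpd; have := pdmx_ge0 (x - y) Xpd.
rewrite -scaleN1r !(bformDl, bformDr, bformZl, bformZr).
have -> : bform X y x = bform X x y by rewrite -bform_tr (pdmx_sym Xpd).
have := pdmx_ge0 x Xpd; have := pdmx_ge0 y Xpd.
rewrite ler_norml => *; apply/andP; split; lra.
Qed.

(* X_k <= kappa th W gives Bbar Bbar^T <= e X_k^-1, so that the inverse in the
   recursion is at most X_k / (1 - e); the contraction of Abar absorbs the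
   factor 1 / (1 - e) and the added th I. *)
Lemma backward_X_le (G : 'M[R]_(n, p)) (W : 'M[R]_n) (q e kappa beta th : R) :
  pdmx W -> 0 < th -> 0 < kappa -> 0 <= beta ->
  0 < e < 1 -> q <= (1 - e) ^+ 2 ->
  (forall x, bform W (Abar A C G *m x) (Abar A C G *m x) <= q * bform W x x) ->
  (forall x, normsq x <= kappa * e * bform W x x) ->
  (forall x, bform (Bbar B D G *m (Bbar B D G)^T) x x <= beta * bform (invmx W) x x) ->
  kappa * th * beta <= e ->
  forall k, pdmx (backward_X A B C D G th k) /\
    forall x, bform (backward_X A B C D G th k) x x <= kappa * th * bform W x x.
Proof.
move=> Wpd th0 ka0 b0 /andP[e0 e1] qe AW IW BW bth.
have kt0 : 0 < kappa * th by exact: mulr_gt0.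
elim=> [|k [Xpd XW]] /=.
  split=> [|x]; first exact: pdmx_scalar.
  rewrite bform_scalar [kappa * th]mulrC -mulrA ler_pM2l //.
  apply: (le_trans (IW x)); rewrite -mulrA ler_pM2l // ler_piMl ?pdmx_ge0 // ltW //.
set X := backward_X _ _ _ _ _ _ k in Xpd XW *.
pose U := invmx X - Bbar B D G *m (Bbar B D G)^T.
have Ipd := pdmxV Xpd.
have WX x : bform (invmx W) x x <= kappa * th * bform (invmx X) x x.
  have := @pdmxV_antitone _ n X ((kappa * th) *: W) Xpd (pdmxZ kt0 Wpd).
  rewrite invmxZ; last by rewrite unitmxZ ?unitfE ?gt_eqF // pdmx_unit.
  move=> /(_ _ x); rewrite bformZ -ler_pdivrMl //; apply=> y.
  by rewrite bformZ.
have UX x : (1 - e) * bform (invmx X) x x <= bform U x x.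
  rewrite bformB mulrBl mul1r lerD2l lerN2; apply: (le_trans (BW x)).
  apply: (le_trans (ler_wpM2l b0 (WX x))).
  by rewrite mulrA [beta * _]mulrC ler_wpM2r // pdmx_ge0.
have e10 : 0 < 1 - e by rewrite subr_gt0.
have Upd : pdmx U.
  split=> [|x x0]; first by rewrite /symmx linearB /= (pdmx_sym Ipd) (psdmx_gram _).1.
  rewrite -/(bform _ x x); apply: lt_le_trans (UX x); rewrite mulr_gt0 //.
  exact: Ipd.2.
have Ypd := pdmxV Upd.
have YX x : bform (invmx U) x x <= (1 - e)^-1 * bform X x x.
  have := @pdmxV_antitone _ n ((1 - e) *: invmx X) U (pdmxZ e10 Ipd) Upd.
  rewrite invmxZ; last by rewrite unitmxZ ?unitfE ?gt_eqF // pdmx_unit.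
  rewrite (invmxK X) => /(_ _ x); rewrite bformZ; apply=> y.
  by rewrite bformZ.
split.
  rewrite addrC; apply: pdmxD; first exact: pdmx_scalar.
  by rewrite -{2}[Abar A C G]trmxK; exact/psdmx_congr/pdmx_psd.
move=> x; rewrite bformD bform_mul trmxK bform_scalar.
have h1 := YX (Abar A C G *m x).
have h2 := XW (Abar A C G *m x).
have h3 := AW x; have h4 := IW x; have w0 := pdmx_ge0 x Wpd.
(* The target bound is shared out: this term takes the fraction [1 - e], the added th I takes
   [e]. *)
have h5 : (1 - e)^-1 * bform X (Abar A C G *m x) (Abar A C G *m x) <=
          kappa * th * ((1 - e) * bform W x x).
  rewrite ler_pdivrMl //; apply: (le_trans h2).
  rewrite mulrCA ler_pM2l //; apply: (le_trans h3).
  by rewrite mulrA -expr2 ler_wpM2r.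
have h6 : th * normsq x <= kappa * th * (e * bform W x x).
  by rewrite [kappa * th]mulrC -mulrA ler_pM2l // mulrA.
move: (le_trans h1 h5) h6; lra.
Qed.

Lemma backward_X_limit_le (G : 'M[R]_(n, p)) (th : R) (W X : 'M[R]_n) (a : R) :
  (forall k, pdmx (backward_X A B C D G th k) /\
    forall x, bform (backward_X A B C D G th k) x x <= a * bform W x x) ->
  backward_X A B C D G th @ \oo --> X ->
  forall i j, `|X i j| <= a * (W i i + W j j).
Proof.
move=> Xle /cvg_mxP XX i j.
apply: (cvgr_to_le (cvg_norm (XX i j))); near=> k.
have [Xpd XW] := Xle k.
rewrite -bform_delta; apply: (le_trans (psd_bform_le _ _ Xpd)).
by rewrite mulrDr -!(bform_delta W); exact: lerD.
Unshelve. all: by end_near. Qed.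

(** [Z] tends to the limit of Abar, so the given [P] survives as its Lyapunov matrix; the inverse
    [W] controls the backward recursion. *)
Lemma closed_loop_lyapunov (theta : R -> R) (G : R -> 'M[R]_(n, p)) (G0 : 'M[R]_(n, p))
    (P : 'M[R]_n) :
  pdmx P -> pdmx (P - Abar A C G0 *m P *m (Abar A C G0)^T) ->
  (\forall c \near 0^'+, 0 < theta c) -> theta c @[c --> 0^'+] --> 0 ->
  Abar A C (G c) @[c --> 0^'+] --> Abar A C G0 ->
  Bbar B D (G c) @[c --> 0^'+] --> Bbar B D G0 ->
  \forall c \near 0^'+, forall X : 'M[R]_n,
    backward_X A B C D (G c) (theta c) @ \oo --> X ->
    let Z := Abar A C (G c) + Bbar B D (G c) *m Hmx A B C D (G c) X in
    pdmx (P - Z *m P *m Z^T).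
Proof.
move=> Ppd Lpd th0 thc Ac Bc.
have Wpd := pdmxV Ppd; set W := invmx P in Wpd.
have WP : invmx W = P by exact: invmxK.
have [q /andP[q0 q1] qP] := near_contraction Ppd Lpd Ac.
(* Then [1 - e = (1 + q) / 2], whose square is at least [q] by the arithmetic-geometric mean
   inequality. *)
pose e := (1 - q) / 2.
have e01 : 0 < e < 1 by rewrite /e; apply/andP; split; lra.
have e0 : 0 < e by case/andP: e01.
have qe : q <= (1 - e) ^+ 2 by rewrite /e; nra.
have [w w0 wP] := pdmx_lower Wpd.
pose kappa := (w * e)^-1.
have ka0 : 0 < kappa by rewrite invr_gt0 mulr_gt0.
have IW x : normsq x <= kappa * e * bform W x x.
  by rewrite /kappa invfM mulfVK ?gt_eqF // -ler_pdivrMl ?invr_gt0 // invrK.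
have BBc : Bbar B D (G c) *m (Bbar B D (G c))^T @[c --> 0^'+] -->
           Bbar B D G0 *m (Bbar B D G0)^T.
  by apply: cvg_mulmx => //; exact: cvg_trmx.
have [v v0 vP] := pdmx_lower Ppd.
(* The added 1 leaves room for Bbar at small [c]; [beta] then combines the factor of [bform_le] with
   the lower bound [v] of [P]. *)
pose b : R := `|Bbar B D G0 *m (Bbar B D G0)^T| + 1.
have b0 : 0 <= b by rewrite addr_ge0.
pose beta : R := b * (n + n)%:R * 2 / v.
have beta0 : 0 <= beta by rewrite divr_ge0 ?mulr_ge0 // ltW.
have bound : \forall c \near 0^'+, forall k,
    pdmx (backward_X A B C D (G c) (theta c) k) /\
    forall x, bform (backward_X A B C D (G c) (theta c) k) x x <=
      kappa * theta c * bform W x x.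
  near=> c; apply: (@backward_X_le _ W q e kappa beta) => //.
  - by near: c.
  (* Duality carries the rate of the transpose of Abar in [P] over to Abar in [W]. *)
  - apply: contraction_dual => //; near: c; exact: qP.
  - move=> x; rewrite WP.
    apply: (le_trans (ler_norm _)); apply: (le_trans (bform_le _ _ _)).
    have xv : normsq x <= v^-1 * bform P x x by rewrite ler_pdivlMl.
    have Bn : `|Bbar B D (G c) *m (Bbar B D (G c))^T| <= b.
      by near: c; apply: cvgr_norm_le BBc _ _; rewrite ltrDl.
    have := ler_wpM2r (mulr_ge0 (ler0n R (n + n)) (normsq_ge0 x)) Bn.
    have := ler_wpM2l (mulr_ge0 b0 (ler0n R (n + n))) xv.
    rewrite /beta; lra.
  - near: c.
    have : kappa * theta c * beta @[c --> 0^'+] --> kappa * 0 * beta.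
      by apply: cvgM; [apply: cvgM => //|]; exact: cvg_cst.
    by rewrite mulr0 mul0r => /cvgr_le; exact.
(* Selecting the limit makes it a function of [c], whose own limit can be taken; the default 0
   covers any [c] where the recursion diverges. *)
pose Xf c := xget 0 [set X : 'M[R]_n | backward_X A B C D (G c) (theta c) @ \oo --> X].
have XfE c X : backward_X A B C D (G c) (theta c) @ \oo --> X -> X = Xf c.
  move=> cX.
  have : [set X : 'M[R]_n | backward_X A B C D (G c) (theta c) @ \oo --> X] (Xf c).
    by apply: xgetPex; exists X.
  exact: (cvg_unique (@norm_hausdorff _ _) cX).
have Xf0 : Xf c @[c --> 0^'+] --> (0 : 'M[R]_n).
  apply/cvg_mxP => i j; rewrite mxE; apply/norm_cvg0P.
  apply: (@squeeze_cvgr _ _ _ _ (fun=> 0) (fun c => kappa * theta c * (W i i + W j j))).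
  - near=> c; rewrite normr_ge0 /= /Xf; case: xgetP => [X _ /= cX|_].
      apply: backward_X_limit_le cX _ _; near: c; exact: bound.
    rewrite mxE normr0 mulr_ge0 //.
      by rewrite mulr_ge0 ?ltW //; near: c.
    by rewrite -!(bform_delta W) addr_ge0 // pdmx_ge0.
  - exact: cvg_cst.
  - have : kappa * theta c * (W i i + W j j) @[c --> 0^'+] -->
           kappa * 0 * (W i i + W j j).
      by apply: cvgM; [apply: cvgM => //|]; exact: cvg_cst.
    by rewrite mulr0 mul0r.
have Zc : Abar A C (G c) + Bbar B D (G c) *m Hmx A B C D (G c) (Xf c) @[c --> 0^'+] -->
          Abar A C G0.
  have BXB : (Bbar B D (G c))^T *m Xf c *m Bbar B D (G c) @[c --> 0^'+] -->
             (Bbar B D G0)^T *m 0 *m Bbar B D G0.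
    by do 2 apply: cvg_mulmx => //; exact: cvg_trmx.
  rewrite mulmx0 mul0mx in BXB.
  have Kc : Ktilde B D (G c) (Xf c) @[c --> 0^'+] --> (invmx 1%:M : 'M[R]_(n + p)).
    apply: cvg_invmx; first exact: unitmx1.
    by rewrite -[X in _ --> X]subr0; apply: cvgB BXB; exact: cvg_cst.
  have Hc : Hmx A B C D (G c) (Xf c) @[c --> 0^'+] -->
      invmx 1%:M *m (Bbar B D G0)^T *m 0 *m Abar A C G0.
    by apply: cvg_mulmx Ac; apply: cvg_mulmx Xf0; apply: cvg_mulmx Kc _; exact: cvg_trmx.
  rewrite mulmx0 mul0mx in Hc.
  have BHc : Bbar B D (G c) *m Hmx A B C D (G c) (Xf c) @[c --> 0^'+] --> (0 : 'M[R]_n).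
    by rewrite -(mulmx0 _ (Bbar B D G0)); exact: cvg_mulmx Bc Hc.
  rewrite -(addr0 (Abar A C G0)).
  exact: (@cvgD _ _ _ _ _ (fun c => Abar A C (G c))
    (fun c => Bbar B D (G c) *m Hmx A B C D (G c) (Xf c)) _ _ Ac BHc).
have [r /andP[r0 r1] rP] := near_contraction Ppd Lpd Zc.
apply: filterS rP => c rP X /XfE ->.
set Z := Abar A C (G c) + _ in rP *.
rewrite /=; split.
  by rewrite /symmx linearB /= !trmx_mul trmxK (pdmx_sym Ppd) mulmxA.
move=> x x0; rewrite -/(bform _ x x) bformB bform_mul.
have := rP x; have : 0 < bform P x x by exact: Ppd.2.
nra.
Unshelve. all: by end_near. Qed.

End BackwardRecursion.

(** * Block-triangular form of F and convergence of the covariance *)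

Lemma FmxE (R : realType) n p (A : 'M[R]_n) (B : 'M[R]_(n, n + p))
    (C : 'M[R]_(p, n)) (D : 'M[R]_(p, n + p)) G X G' :
  Fmx A B C D G X G' = block_mx (A - G' *m C)
    (B *m Hmx A B C D G X - G' *m (D *m Hmx A B C D G X)) 0
    (Abar A C G + Bbar B D G *m Hmx A B C D G X).
Proof.
rewrite /Fmx /Atilde /Ctilde mul_col_row !mul0mx opp_block_mx add_block_mx.
by rewrite !subr0.
Qed.

Theorem proposition4p1 (R : realType) (n p : nat)
    (A : 'M[R]_n) (B : 'M[R]_(n, n + p))
    (C : 'M[R]_(p, n)) (D : 'M[R]_(p, n + p))
    (P0 : 'M[R]_n)
    (cmax cbar : R) (theta : R -> R) (P V : R -> 'M[R]_n)
    (G : R -> 'M[R]_(n, p))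
    (G'_ : nat -> 'M[R]_(n, p)) (G' : 'M[R]_(n, p)) :
  (0 < n)%N -> (0 < p)%N ->
  filter_model A B C D ->
  pdmx P0 ->
  0 < cmax ->
  filter_limits A B C D cmax theta P V G ->
  bar_continuity A B C D ->
  0 < cbar <= cmax ->
  admissible_cbar A B C D theta G cbar ->
  G'_ @ \oo --> G' ->
  stable (A - G' *m C) ->
  exists2 c0 : R, 0 < c0 <= cbar &
  forall c : R, 0 < c <= c0 ->
  forall (X : 'M[R]_n) (L : 'M[R]_(n + p)),
    backward_X A B C D (G c) (theta c) @ \oo --> X ->
    Ktilde B D (G c) X = L *m L^T ->
  exists2 Pi : 'M[R]_(n + n),
    unique (Lyapunov_solution A B C D (G c) X L G') Pi &
    Pi_seq A B C D (G c) X L G'_ P0 @ \oo --> Pi.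
Proof.
(* Positive dimension supplies the diagonal entry used to bound theta. *)
case: n A B C D P0 P V G G'_ G' => [//|n] A B C D P0 P V G G'_ G' _ _ model P0pd.
move=> cmax0 limits barc /andP[cbar0 cbarm] _ G'cvg G'st.
have thc := theta_cvg0 model cmax0 limits.
have [Q Qsol [Ac Bc]] := bar_cvg model cmax0 limits thc barc.
have Qpd : pdmx Q by case: Qsol.
have th0 : \forall c \near 0^'+, 0 < theta c.
  near=> c; have [] // := @filter_limits_eqs R n.+1 p A B C D cmax theta P V G model limits c.
  by apply/andP; split; near: c; [exact: nbhs_right_gt|exact: nbhs_right_le].
have [d /= d0 dP] :=
  closed_loop_lyapunov Qpd (kalman_lyapunov model Qsol) th0 thc Ac Bc.
(* The closed-loop inequality holds for [0 < c < d]; halving [d] allows the closed bound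
   [c <= c0]. *)
exists (Num.min (d / 2) cbar).
  by rewrite lt_min divr_gt0 // cbar0 ge_min lexx orbT.
move=> c /andP[c0]; rewrite le_min => /andP[cd _] X L Xc KL.
have cball : `|0 - c| < d by rewrite sub0r normrN gtr0_norm //; lra.
have Zpd := dP c cball c0 X Xc.
have [W1 W1pd L1] := stable_lyapunov G'st.
(* [W1] serves the block A - G'C and [Q] the closed loop, whatever the coupling block. *)
have [W Wpd LW] := block_lyapunov
  (B *m Hmx A B C D (G c) X - G' *m (D *m Hmx A B C D (G c) X)) W1pd L1 Qpd Zpd.
rewrite -FmxE in LW.
have cc k l (S : 'M[R]_(k, l)) : (fun _ : nat => S) @ \oo --> S by exact: cvg_cst.
have colc : col_mx (G'_ t) 0 @[t --> \oo] --> (col_mx G' 0 : 'M[R]_(n.+1 + n.+1, p)).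
  exact: cvg_col_mx.
have Fc : Fmx A B C D (G c) X (G'_ t) @[t --> \oo] --> Fmx A B C D (G c) X G'.
  by apply: cvgB; [exact: cc|apply: cvg_mulmx colc _; exact: cc].
have Mc : Mmx B D (G c) L (G'_ t) @[t --> \oo] --> Mmx B D (G c) L G'.
  by apply: cvgB; [exact: cc|apply: cvg_mulmx colc _; exact: cc].
exact: (lyapunov_iteration_cvg Wpd LW Fc Mc).
Unshelve. all: by end_near. Qed.
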